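(* Let $f\colon[0,1]\to[0,1]$ be defined by - $f(x)=x+18x^3$ for $x\in[0,1/3]$, - $f(x)=x+72(x-\tfrac12)^3$ for $x\in(1/3,2/3)$, - $f(x)=x+18(x-1)^3$ for $x\in[2/3,1]$. Then for every closed connected subset $\mathcal C\subset\mathcal S$, $$\dim_{\rm H}\{x\in[0,1]\colon\mathcal V(x)=\pi\mathcal C\}=1 .$$ In particular, $\dim_{\rm H}\{x\colon e_n(x)\to\nu_{\bar p}\}=1$ for every $\bar p\in\mathcal S$.
   Context: The map $f$ has neutral fixed points $\xi_1=0$, $\xi_2=1/2$, $\xi_3=1$. $e_n(x)=\frac1n\sum_{k=0}^{n-1}\delta_{f^kx}$ is the $n$th empirical measure, and $\mathcal V(x)$ is the set of weak$*$ limit points of $(e_n(x))_n$. Let $\mathcal S=\{\bar p\in[0,1]^3\colon p_1+p_2+p_3=1\}$, and let $\pi(\bar p)=\nu_{\bar p}=\sum_{j=1}^3p_j\delta_{\xi_j}$. *)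

(* Defs.v *)
From HB Require Import structures.
From mathcomp Require Import all_boot all_order all_algebra.
From mathcomp Require Import all_classical all_reals all_analysis.
Set Implicit Arguments. Unset Strict Implicit. Unset Printing Implicit Defensive.
Import Order.TTheory GRing.Theory Num.Theory.
Import numFieldNormedType.Exports.
Local Open Scope classical_set_scope.
Local Open Scope ring_scope.

Section Defs.
Variable R : realType.

(** The map f of the paper (given on [0,1]; values outside [0,1] are irrelevant). *)
Definition fmap (x : R) : R :=
  if x <= 3^-1 then x + 18 * x ^+ 3
  else if x < 2 / 3 then x + 72 * (x - 2^-1) ^+ 3
  else x + 18 * (x - 1) ^+ 3.

(** Neutral fixed points xi_1 = 0, xi_2 = 1/2, xi_3 = 1. *)
Definition xi1 : R := 0.
Definition xi2 : R := 2^-1.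
Definition xi3 : R := 1.

(** Integral of g against the empirical measure e_n(x) = (1/n) sum_{k<n} delta_{f^k x}. *)
Definition emp_avg (n : nat) (x : R) (g : R -> R) : R :=
  n%:R^-1 * \sum_(k < n) g (iter k fmap x).

Definition simplex : set (R * R * R) :=
  [set p | [/\ 0 <= p.1.1, 0 <= p.1.2, 0 <= p.2 & p.1.1 + p.1.2 + p.2 = 1]].

Definition nu (p : R * R * R) (A : set R) : \bar R :=
  (p.1.1%:E * \d_xi1 A + p.1.2%:E * \d_xi2 A + p.2%:E * \d_xi3 A)%E.

Definition nu_int (p : R * R * R) (g : R -> R) : R :=
  p.1.1 * g xi1 + p.1.2 * g xi2 + p.2 * g xi3.

(** Borel probability measures on [0,1] are represented as probability
    measures on R (they are then automatically concentrated on [0,1] when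
    they are weak* limits of the e_n(x)).  Weak* convergence is tested against
    functions continuous on [0,1]. *)
Definition weak_limit_point (x : R) (mu : probability R R) : Prop :=
  exists phi : nat -> nat, (forall k, (phi k < phi k.+1)%N) /\
    forall g : R -> R, {within `[0, 1], continuous g} ->
      ((fun k => (emp_avg (phi k) x g)%:E) @ \oo -->
         (\int[mu]_(y in `[0%R, 1%R]) (g y)%:E)%E).

Definition V_eq_piC (x : R) (C : set (R * R * R)) : Prop :=
  forall mu : probability R R,
    weak_limit_point x mu <->
    exists2 p, C p & forall A, measurable A -> mu A = nu p A.

Definition emp_cvg_to (x : R) (p : R * R * R) : Prop :=
  forall g : R -> R, {within `[0, 1], continuous g} ->
    (fun n => emp_avg n x g) @ \oo --> nu_int p g.

Definition diam (U : set R) : \bar R :=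
  ereal_sup ([set 0%E] `|` [set (`|y - z|)%:E | y in U & z in U]).

Definition hausdorff_content (s delta : R) (E : set R) : \bar R :=
  ereal_inf [set (\sum_(0 <= i <oo) (powR (fine (diam (U i))) s)%:E)%E
            | U in [set U : nat -> set R |
                    E `<=` \bigcup_i U i /\ forall i, (diam (U i) <= delta%:E)%E]].

Definition hausdorff_measure (s : R) (E : set R) : \bar R :=
  ereal_sup [set hausdorff_content s delta E | delta in [set d : R | 0 < d]].

Definition hausdorff_dim (E : set R) : \bar R :=
  ereal_inf [set s%:E | s in [set s : R | 0 < s /\ hausdorff_measure s E = 0%E]].

End Defs.

(* Main.v *)
Require Import Defs.
From HB Require Import structures.
From mathcomp Require Import all_boot all_order all_algebra.
From mathcomp Require Import all_classical all_reals all_analysis.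
From mathcomp Require Import measurable_realfun ring lra zify.
Import Order.TTheory GRing.Theory Num.Theory.
Import numFieldNormedType.Exports.
Set Implicit Arguments. Unset Strict Implicit. Unset Printing Implicit Defensive.
Local Open Scope classical_set_scope.
Local Open Scope ring_scope.

(** Code a point of [0,1] by its itinerary under the three full branches, and cut
    the itinerary into "digits" j^l e with e <> j (a run followed by a change of
    symbol).  Inverse branches along words of digits contract by 9/11 per digit and
    have uniformly bounded distortion, because within a run the cylinders at
    successive times are disjoint, so the total variation of the logarithm of the
    derivative telescopes.

    Take all itineraries u_0 v_0 u_1 v_1 ... in which u_i is an arbitrary word of
    (i+1)^2 digits with run lengths bounded by L, and v_i is a fixed word made of
    three runs 0^a 1^b 2^c with (a,b,c) close to (i+1)^3 p_i.  Time is dominated by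
    the long runs, during which the orbit stays near a neutral fixed point, so the
    empirical measures follow the weighted averages of the p_i; since a connected
    set is chainable, these averages can be steered so that their limit set is C.
    Neutrality makes the cylinder of a run of length m only polynomially small in m,
    so inserting v_i costs a factor exponential in i, negligible against the
    contraction rate exponential in i^2 coming from u_i.  Weighting the u_i
    by cylinder length therefore gives masses bounded by C0 * gap^s, as soon as L is
    large enough for the given s < 1.  A cover with small s-sum would then be a set
    of tree nodes of total mass < 1, and a branch avoiding all of them is found
    greedily. *)

(** Three orders of magnitude decide the construction. Up to stage n the blocks v_i and the
    distortion between stages cost factors exponential in n^2, the free words supply about n^3/3
    digits, and the elapsed time is about n^4/4. Hence the gain available for s < 1, exponential in
    the number of free digits, beats every loss, even a crude estimate of the free word of stage n
    itself; and the changes of symbol, of order n^3, have density zero in time. Digits are used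
    instead of symbols because a single symbol does not contract uniformly near a neutral fixed
    point. At the endpoints of the branches f follows only one of the two codes. Every block
    therefore contains the symbol 1, which keeps the whole coded orbit inside the open interval (0,
    1), where itineraries and orbits correspond. *)

Notation s0 := (@Ordinal 3 0 isT).
Notation s1 := (@Ordinal 3 1 isT).
Notation s2 := (@Ordinal 3 2 isT).

Lemma ord3_ind (P : 'I_3 -> Prop) : P s0 -> P s1 -> P s2 -> forall s, P s.
Proof.
move=> P0 P1 P2 [[|[|[|//]]] lts].
- by rewrite (_ : Ordinal lts = s0) //; apply: val_inj.
- by rewrite (_ : Ordinal lts = s1) //; apply: val_inj.
- by rewrite (_ : Ordinal lts = s2) //; apply: val_inj.
Qed.

(** * Inverse branches and cylinders *)

Section Branches.
Variable R : realType.
Implicit Types (s : 'I_3) (x y z : R) (w : seq 'I_3).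

Definition xi s : R := s%:R / 2.
Definition cubic_coef s : R := if s == s1 then 72 else 18.
Definition fwd s x : R := x + cubic_coef s * (x - xi s) ^+ 3.
(** The difference quotient of [fwd s] between [x] and [y]. It replaces the derivative in the
    expansion and distortion estimates, so that no mean value theorem is called for. *)
Definition qf s x y : R :=
  1 + cubic_coef s * ((x - xi s) ^+ 2 + (x - xi s) * (y - xi s) + (y - xi s) ^+ 2).

Lemma cubic_coef_gt0 s : 0 < cubic_coef s.
Proof. by rewrite /cubic_coef; case: ifP => _; lra. Qed.

Lemma fwdB s x y : fwd s y - fwd s x = (y - x) * qf s x y.
Proof. by rewrite /fwd /qf; ring. Qed.

Lemma qf_ge1 s x y : 1 <= qf s x y.
Proof.
rewrite /qf lerDl; apply: mulr_ge0; first exact: ltW (cubic_coef_gt0 _).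
move: (x - _) (y - _) => t u.
by have := sqr_ge0 (t + u); have := sqr_ge0 t; have := sqr_ge0 u; nra.
Qed.

Lemma fwd_mono s : {mono fwd s : x y / x <= y}.
Proof.
apply: le_mono => x y xy; rewrite -subr_gt0 fwdB mulr_gt0 ?subr_gt0//.
exact: lt_le_trans (qf_ge1 _ _ _).
Qed.

Lemma fwd_inj s : injective (fwd s).
Proof. exact: (inc_inj (@fwd_mono s)). Qed.

Lemma fwd_surj s z : exists x, fwd s x = z.
Proof.
pose p : {poly R} := 'X + cubic_coef s *: ('X - (xi s)%:P) ^+ 3 - z%:P.
have pE x : p.[x] = fwd s x - z by rewrite /p /fwd !hornerE.
have c0 := cubic_coef_gt0 s.
(* The branch pushes points away from [xi s], so the images of the two points at distance
   [|z - xi s|] from it enclose [z]. *)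
have := @poly_ivt R p (xi s - `|z - xi s|) (xi s + `|z - xi s|).
case.
- by rewrite lerD2l ge0_cp.
- rewrite !pE /fwd; set t := `|_|.
  have t0 : 0 <= t by rewrite /t.
  have c3 : 0 <= cubic_coef s * t ^+ 3 by rewrite mulr_ge0 ?exprn_ge0 // ltW.
  have /ler_normlP[h1 h2] : `|z - xi s| <= t by [].
  have e1 : xi s - t - xi s = - t by ring.
  have e2 : xi s + t - xi s = t by ring.
  by rewrite e1 e2; apply/andP; split; nra.
- by move=> x _; rewrite rootE pE subr_eq0 => /eqP; exists x.
Qed.

(* [fwd s] is the s-th cubic branch extended to a bijection of the real line,
   so that its inverse is total. *)
Definition inv s z : R := projT1 (cid (fwd_surj s z)).

Lemma invK s z : fwd s (inv s z) = z.
Proof. by rewrite /inv; case: cid. Qed.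

Lemma fwdK s x : inv s (fwd s x) = x.
Proof. by apply: (@fwd_inj s); rewrite invK. Qed.

Lemma inv_mono s : {mono inv s : x y / x <= y}.
Proof. by move=> x y; rewrite -(fwd_mono s) !invK. Qed.

Lemma inv_smono s : {mono inv s : x y / x < y}.
Proof. exact: (leW_mono (@inv_mono s)). Qed.

Lemma invB s x y : (inv s y - inv s x) * qf s (inv s x) (inv s y) = y - x.
Proof. by rewrite -fwdB !invK. Qed.

Lemma inv0 s : inv s 0 = s%:R / 3.
Proof.
apply: (@fwd_inj s); rewrite invK /fwd /cubic_coef /xi.
by elim/ord3_ind: s => /=; field.
Qed.

Lemma inv1 s : inv s 1 = s.+1%:R / 3.
Proof.
apply: (@fwd_inj s); rewrite invK /fwd /cubic_coef /xi.
by elim/ord3_ind: s => /=; field.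
Qed.

Lemma inv_bnd s z : 0 <= z <= 1 -> s%:R / 3 <= inv s z <= s.+1%:R / 3.
Proof. by move=> /andP[z0 z1]; rewrite -inv0 -inv1 !inv_mono z0. Qed.

Lemma inv_01 s z : 0 <= z <= 1 -> 0 <= inv s z <= 1.
Proof.
move=> /(inv_bnd s) /andP[h1 h2].
by elim/ord3_ind: s h1 h2 => /= h1 h2; apply/andP; split; lra.
Qed.

(** The interval is open because at 1/3 and 2/3 the map [fmap] follows only one of the adjacent
    branches. *)
Lemma fmap_inv s z : 0 < z < 1 -> Defs.fmap (inv s z) = z.
Proof.
move=> /andP[z0 z1]; rewrite /Defs.fmap -[RHS](invK s).
have h0 : s%:R / 3 < inv s z by rewrite -inv0 inv_smono.
have h1 : inv s z < s.+1%:R / 3 by rewrite -inv1 inv_smono.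
elim/ord3_ind: s h0 h1 => /= h0 h1; rewrite /fwd /cubic_coef /xi /=.
- by rewrite ifT; [ring|lra].
- rewrite ifF; last by apply/negbTE; rewrite -ltNge; lra.
  by rewrite ifT; [field|lra].
- rewrite ifF; last by apply/negbTE; rewrite -ltNge; lra.
  rewrite ifF; last by apply/negbTE; rewrite -leNgt; lra.
  by field.
Qed.

Definition inv_word w z : R := foldr inv z w.
Definition cyl w : R := inv_word w 1 - inv_word w 0.

Lemma inv_word_cat v w z : inv_word (v ++ w) z = inv_word v (inv_word w z).
Proof. by rewrite /inv_word foldr_cat. Qed.

Lemma inv_word_mono w : {mono inv_word w : x y / x <= y}.
Proof. by elim: w => //= s w IH x y; rewrite inv_mono IH. Qed.

Lemma inv_word_smono w : {mono inv_word w : x y / x < y}.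
Proof. exact: (leW_mono (@inv_word_mono w)). Qed.

Lemma inv_word_01 w z : 0 <= z <= 1 -> 0 <= inv_word w z <= 1.
Proof. by move=> z01; elim: w => //= s w IH; apply: inv_01. Qed.

Lemma inv_word0_01 w : 0 <= inv_word w 0 <= 1. Proof. by apply: inv_word_01; rewrite lexx ler01. Qed.
Lemma inv_word1_01 w : 0 <= inv_word w 1 <= 1. Proof. by apply: inv_word_01; rewrite lexx ler01. Qed.

Lemma cyl_gt0 w : 0 < cyl w.
Proof. by rewrite subr_gt0 inv_word_smono ltr01. Qed.

Lemma cyl_le1 w : cyl w <= 1.
Proof. by rewrite /cyl; have /andP[_ ?] := inv_word1_01 w; have /andP[? _] := inv_word0_01 w; lra. Qed.

Lemma cyl0 : cyl [::] = 1. Proof. by rewrite /cyl/= subr0. Qed.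

Lemma cyl_cat_sub v w : cyl (v ++ w) = inv_word v (inv_word w 1) - inv_word v (inv_word w 0).
Proof. by rewrite /cyl !inv_word_cat. Qed.

Lemma cyl1 s : cyl [:: s] = 3^-1.
Proof.
by rewrite /cyl /= inv0 inv1; elim/ord3_ind: s => /=; field.
Qed.

Lemma cyl_split w : cyl w = \sum_(s < 3) cyl (w ++ [:: s]).
Proof.
rewrite !big_ord_recl big_ord0 !cyl_cat_sub /cyl /= !inv0 !inv1 /= addr0.
rewrite mul0r (_ : 3%:R / 3 = 1); last by field.
by ring.
Qed.

Lemma cyl_cons s w : cyl (s :: w) * qf s (inv_word (s :: w) 0) (inv_word (s :: w) 1) = cyl w.
Proof. exact: invB. Qed.

Lemma cyl_cons_le s w : cyl (s :: w) <= cyl w.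
Proof. by rewrite -[leRHS](cyl_cons s) ler_peMr ?qf_ge1// ltW ?cyl_gt0. Qed.

Lemma cyl_catl_le v w : cyl (v ++ w) <= cyl w.
Proof. by elim: v => //= s v IH; apply: le_trans (cyl_cons_le _ _) IH. Qed.

Lemma xi_01 s : 0 <= xi s <= 1.
Proof. by rewrite /xi; elim/ord3_ind: s => /=; apply/andP; split; lra. Qed.

Lemma inv_word_cyl_fix w x : inv_word w 0 <= x <= inv_word w 1 -> exists2 z, 0 <= z <= 1 & x = inv_word w z.
Proof.
elim: w x => [|s w IH] x /=; first by exists x.
move=> /andP[h0 h1].
have [|z z01 ez] := IH (fwd s x).
  by rewrite -(inv_mono s) fwdK h0 -(inv_mono s) fwdK h1.
by exists z => //; rewrite -ez fwdK.
Qed.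

(** The far end of a branch is at distance 1/3 from the fixed point with coefficient 18, or 1/6 with
    coefficient 72; both give 2. *)
Lemma inv_dev s z : 0 <= z <= 1 -> cubic_coef s * (inv s z - xi s) ^+ 2 <= 2.
Proof.
move=> /(inv_bnd s) /andP[].
by elim/ord3_ind: s => /= h1 h2; rewrite /cubic_coef /xi /=; nra.
Qed.

(* With v = cubic_coef * t^2, one backward step increases 1/v by
   (2 + v) / (1 + v)^2, which is at least 4/9 for v <= 2. *)
Lemma neutral_dev m s z : 0 <= z <= 1 ->
  m%:R * (cubic_coef s * (inv_word (nseq m s) z - xi s) ^+ 2) <= 9 / 4.
Proof.
move=> z01; elim: m => [|[|m] IH]; first by rewrite mul0r; lra.
  by rewrite mul1r; apply: le_trans (inv_dev _ z01) _; lra.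
have w01 := inv_word_01 (nseq m.+1 s) z01.
have dev := inv_dev s w01.
have -> : inv_word (nseq m.+2 s) z = inv s (inv_word (nseq m.+1 s) z) by [].
move: dev IH; set y := inv_word (nseq m.+1 s) z.
have : y - xi s = (inv s y - xi s) * (1 + cubic_coef s * (inv s y - xi s) ^+ 2).
  by rewrite -{1}(invK s y) /fwd; ring.
move: (inv s y - xi s) => t ->.
set v := cubic_coef s * t ^+ 2 => v2.
have v0 : 0 <= v by rewrite mulr_ge0 ?exprn_even_ge0// ltW ?cubic_coef_gt0.
have -> : cubic_coef s * (t * (1 + v)) ^+ 2 = v * (1 + v) ^+ 2.
  by rewrite /v; ring.
have -> : m.+2%:R = 1 + m.+1%:R :> R by rewrite -natr1 addrC.
move: (m.+1%:R : R) (ler0n R m.+1) => M M0 IH.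
have [->|vn0] := eqVneq v 0; first by rewrite mulr0; lra.
have vp : 0 < v by rewrite lt_neqAle eq_sym vn0.
have key : (1 + M) * v * (1 + v) ^+ 2 <= 9 / 4 * (1 + v) ^+ 2 by nra.
by rewrite -(ler_pM2r (_ : 0 < (1 + v) ^+ 2)) // exprn_gt0//; lra.
Qed.

(** The constant is 9/4 divided by the smallest coefficient, 18. *)
Lemma neutral_close m s z : 0 <= z <= 1 ->
  m%:R * (inv_word (nseq m s) z - xi s) ^+ 2 <= 8^-1.
Proof.
move=> z01; have := @neutral_dev m s z z01.
set t := (_ ^+ 2); have t0 : 0 <= t by rewrite exprn_even_ge0.
have c : 18 <= cubic_coef s by rewrite /cubic_coef; case: ifP; lra.
have m0 := ler0n R m.
rewrite mulrCA; set u := m%:R * t; have u0 : 0 <= u by rewrite mulr_ge0.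
by nra.
Qed.

Lemma cyl_nseq_sq m s : m%:R * cyl (nseq m s) ^+ 2 <= 2^-1.
Proof.
have h0 := @neutral_close m s 0; have h1 := @neutral_close m s 1.
have := h0 _; rewrite lexx ler01 => /(_ isT).
have := h1 _; rewrite lexx ler01 => /(_ isT).
rewrite /cyl.
have -> : inv_word (nseq m s) 1 - inv_word (nseq m s) 0 =
  (inv_word (nseq m s) 1 - xi s) - (inv_word (nseq m s) 0 - xi s) by ring.
move: (inv_word (nseq m s) 1 - xi s) (inv_word (nseq m s) 0 - xi s) => a b.
have m0 := ler0n R m; move: (m%:R : R) m0 => M M0.
by have := mulr_ge0 M0 (sqr_ge0 (a + b)); nra.
Qed.

(** By [neutral_dev], prepending a symbol to a run of length M - 1 divides the length by at most 1 +
    7/M, since 3 * 9/4 < 7. As 1 + 7/M <= (1 + 1/M)^7, the product along the run telescopes to a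
    seventh power. *)
Lemma cyl_run_ge m s e : 1 <= 3 * cyl (nseq m s ++ [:: e]) * m.+1%:R ^+ 7.
Proof.
elim: m => [|m IH]; first by rewrite /= cyl1 expr1n; lra.
have e0 : 0 <= inv_word [:: e] 0 <= 1 := inv_word0_01 _.
have e1 : 0 <= inv_word [:: e] 1 <= 1 := inv_word1_01 _.
have := @neutral_dev m.+1 s _ e0; have := @neutral_dev m.+1 s _ e1.
have := cyl_cons s (nseq m s ++ [:: e]).
rewrite -!inv_word_cat /qf.
rewrite -/(cyl _).
have -> : s :: nseq m s ++ [:: e] = nseq m.+1 s ++ [:: e] by [].
set a := inv_word _ 0 - _; set b := inv_word _ 1 - _.
have := cyl_gt0 (nseq m.+1 s ++ [:: e]); have := cyl_gt0 (nseq m s ++ [:: e]).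
move: IH; move: (cyl (nseq m s ++ _)) (cyl (nseq m.+1 s ++ _)) => X Y IH X0 Y0 YX hb ha.
have c0 := cubic_coef_gt0 s.
have M0 : 0 < m.+1%:R :> R by rewrite ltr0n.
have -> : m.+2%:R = 1 + m.+1%:R :> R by rewrite -natr1 addrC.
move: (m.+1%:R : R) M0 IH ha hb => M M0 IH ha hb.
have hq : M * (1 + cubic_coef s * (a ^+ 2 + a * b + b ^+ 2)) <= M + 7.
  have : a * b <= (a ^+ 2 + b ^+ 2) / 2 by have := sqr_ge0 (a - b); lra.
  move: (a * b) => ab hab.
  have : M * (cubic_coef s * ab) <= M * (cubic_coef s * ((a ^+ 2 + b ^+ 2) / 2)).
    by rewrite !ler_wpM2l// ?ltW.
  by nra.
have hX : M * X <= Y * (M + 7) by rewrite -YX mulrCA ler_wpM2l// ltW.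
apply: le_trans IH _.
rewrite -!mulrA ler_wpM2l ?ler0n//.
have -> : X * M ^+ 7 = (M * X) * M ^+ 6 by ring.
apply: le_trans (ler_wpM2r _ hX) _; first by rewrite exprn_ge0 ?ltW.
rewrite -mulrA ler_wpM2l ?ltW//.
have M6 n : 0 <= M ^+ n by rewrite exprn_ge0 ?ltW.
have -> : (1 + M) ^+ 7 = (M + 7) * M ^+ 6 + 21 * M ^+ 5 + 35 * M ^+ 4 + 35 * M ^+ 3 + 21 * M ^+ 2 + 7 * M + 1 by ring.
by have := M6 5; have := M6 4; have := M6 3; have := M6 2; lra.
Qed.

End Branches.

(** * Bounded distortion *)

Section Distortion.
Variable R : realType.
Implicit Types (s j e : 'I_3) (x y z : R) (w v : seq 'I_3).
Local Notation inv_word := (@inv_word R).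
Local Notation cyl := (@cyl R).

(** 432 = 72 * 6: the coefficient is at most 72, and each of the three quadratic terms varies by at
    most 2D on an interval of length D inside [0, 1]. The additive bound becomes multiplicative
    because [qf] is at least 1. *)
Lemma qf_dist s l D x y x' y' : 0 <= l -> l + D <= 1 ->
  l <= x <= l + D -> l <= y <= l + D -> l <= x' <= l + D -> l <= y' <= l + D ->
  qf s x y <= qf s x' y' * (1 + 432 * D).
Proof.
move=> l0 lD1 /andP[x1 x2] /andP[y1 y2] /andP[x3 x4] /andP[y3 y4].
have D0 : 0 <= D by lra.
have q1 := qf_ge1 s x' y'.
suff : qf s x y <= qf s x' y' + 432 * D by nra.
have /andP[xi0 xi1] := xi_01 R s.
have c0 := cubic_coef_gt0 R s.
have c72 : cubic_coef R s <= 72 by rewrite /cubic_coef; case: ifP; lra.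
rewrite /qf.
move: (xi R s) xi0 xi1 => a a0 a1.
set T := (X in 1 + cubic_coef R s * X <= _); set T' := (X in _ <= 1 + cubic_coef R s * X + _).
suff : T - T' <= 6 * D by nra.
rewrite /T /T'.
have h1 : (x - a) ^+ 2 - (x' - a) ^+ 2 <= 2 * D by nra.
have h2 : (y - a) ^+ 2 - (y' - a) ^+ 2 <= 2 * D by nra.
have h3 : (x - a) * (y - a) - (x' - a) * (y' - a) <= 2 * D.
  have : (x - a) * (y - y') <= D by nra.
  have : (y' - a) * (x - x') <= D by nra.
  by lra.
by lra.
Qed.

(** These are the lengths of the successive intervals produced while the inverse branches of [w] are
    applied one by one; the distortion of [inv_word w] is at most exponential in their sum. *)
Fixpoint sumcyl w : R := if w is _ :: w' then cyl w + sumcyl w' else 0.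

Lemma inv_word_in_cyl w z : 0 <= z <= 1 -> inv_word w 0 <= inv_word w z <= inv_word w 0 + cyl w.
Proof. by rewrite /cyl addrC subrK !inv_word_mono. Qed.

(** Each symbol costs a factor 1 + 432 times the current cylinder length, absorbed into the
    exponential. The comparison of the two ratios of lengths is cross-multiplied so that degenerate
    intervals are allowed. *)
Lemma distortion w (a b c d : R) : 0 <= a <= b -> b <= 1 -> 0 <= c <= d -> d <= 1 ->
  (inv_word w b - inv_word w a) * (d - c) <= expR (432 * sumcyl w) * ((inv_word w d - inv_word w c) * (b - a)).
Proof.
move=> /andP[a0 ab] b1 /andP[c0 cd] d1.
have a1 : a <= 1 by exact: le_trans ab b1.
have b0 : 0 <= b by exact: le_trans a0 ab.
have c1 : c <= 1 by exact: le_trans cd d1.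
have d0 : 0 <= d by exact: le_trans c0 cd.
elim: w => [|s w IH] /=; first by rewrite mulr0 expR0 mul1r mulrC.
have inI z : 0 <= z -> z <= 1 -> inv_word (s :: w) 0 <= inv_word (s :: w) z <= inv_word (s :: w) 0 + cyl (s :: w).
  by move=> z0 z1; apply: inv_word_in_cyl; rewrite z0.
have /andP[l0 _] := inv_word0_01 R (s :: w); have /andP[_ l1] := inv_word1_01 R (s :: w).
have := @qf_dist s _ _ (inv_word (s :: w) c) (inv_word (s :: w) d) (inv_word (s :: w) a) (inv_word (s :: w) b)
  l0 _ (inI _ c0 c1) (inI _ d0 d1) (inI _ a0 a1) (inI _ b0 b1).
have -> : inv_word (s :: w) 0 + cyl (s :: w) = inv_word (s :: w) 1 by rewrite /cyl addrC subrK.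
move=> /(_ l1).
have := expR_ge1Dx (432 * cyl (s :: w)).
have := invB s (inv_word w a) (inv_word w b); have := invB s (inv_word w c) (inv_word w d).
rewrite -/(inv_word (s :: w) a) -/(inv_word (s :: w) b) -/(inv_word (s :: w) c) -/(inv_word (s :: w) d).
have := qf_ge1 s (inv_word (s :: w) a) (inv_word (s :: w) b).
rewrite (mulrDr 432 (cyl (s :: w)) (sumcyl w)) expRD.
move: (qf s (inv_word (s :: w) a) (inv_word (s :: w) b)) (qf s (inv_word (s :: w) c) (inv_word (s :: w) d)) => q q' q1 e1 e2 he hq.
have DC : 0 <= inv_word (s :: w) d - inv_word (s :: w) c by rewrite subr_ge0 inv_word_mono.
move: e1 e2 IH DC.
move: (inv_word (s :: w) d - inv_word (s :: w) c) (inv_word (s :: w) b - inv_word (s :: w) a) => X Y.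
move: (expR (432 * cyl (s :: w))) (expR (432 * sumcyl w)) (expR_ge0 (432 * sumcyl w)) he.
move=> e E E0 he <- <- IH X0.
have q0 : 0 < q by lra.
rewrite -(ler_pM2r q0).
have -> : Y * (d - c) * q = Y * q * (d - c) by ring.
apply: le_trans IH _.
have qe : q' <= q * e by apply: le_trans hq _; rewrite ler_wpM2l// ltW.
have -> : e * E * (X * (b - a)) * q = E * (X * (q * e) * (b - a)) by ring.
by rewrite ler_wpM2l// ler_wpM2r ?subr_ge0// ler_wpM2l.
Qed.

Lemma cyl_cat_le w v : cyl (w ++ v) <= expR (432 * sumcyl w) * (cyl w * cyl v).
Proof.
have /andP[l0 _] := inv_word0_01 R v; have /andP[_ l1] := inv_word1_01 R v.
have := @distortion w (inv_word v 0) (inv_word v 1) 0 1.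
by rewrite inv_word_mono l0 ler01 !lexx l1 subr0 mulr1 => /(_ isT isT isT isT); rewrite -!inv_word_cat.
Qed.

Lemma cyl_cat_ge w v : cyl w * cyl v <= expR (432 * sumcyl w) * cyl (w ++ v).
Proof.
have /andP[l0 _] := inv_word0_01 R v; have /andP[_ l1] := inv_word1_01 R v.
have := @distortion w 0 1 (inv_word v 0) (inv_word v 1).
by rewrite inv_word_mono l0 ler01 !lexx l1 subr0 mulr1 => /(_ isT isT isT isT); rewrite -!inv_word_cat.
Qed.

Lemma nseqS_cat n j : nseq n.+1 j = nseq n j ++ [:: j].
Proof. by elim: n => //= n <-. Qed.

Lemma inv_sep e j : (e < j)%N -> inv e (1 : R) <= inv j 0.
Proof.
move=> ej; rewrite inv0 inv1 ler_wpM2r ?invr_ge0 ?ler0n// ler_nat//.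
Qed.

(* The cylinders of j^i e, for varying i, do not overlap: their images march
   monotonically towards the fixed point of j. *)
Lemma run_sum e j n : e != j -> \sum_(i < n) cyl (nseq i j ++ [:: e]) <= 1.
Proof.
move=> ej; have [lt|gt] : (e < j)%N \/ (j < e)%N.
  by apply/orP; rewrite -neq_ltn.
- suff : \sum_(i < n) cyl (nseq i j ++ [:: e]) <= inv_word (nseq n j) 0.
    by move=> h; apply: le_trans h _; have /andP[] := inv_word0_01 R (nseq n j).
  elim: n => [|n IH]; first by rewrite big_ord0.
  rewrite nseqS_cat inv_word_cat big_ord_recr /=.
  rewrite cyl_cat_sub; move: IH; set Z := \sum_(_ < _) _.
  have : inv_word (nseq n j) (inv_word [:: e] 1) <= inv_word (nseq n j) (inv_word [:: j] 0) by rewrite inv_word_mono /= inv_sep.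
  have : inv_word (nseq n j) 0 <= inv_word (nseq n j) (inv_word [:: e] 0).
    by rewrite inv_word_mono; have /andP[] := inv_word0_01 R [:: e].
  by lra.
- suff : \sum_(i < n) cyl (nseq i j ++ [:: e]) <= 1 - inv_word (nseq n j) 1.
    by move=> h; apply: le_trans h _; have /andP[] := inv_word1_01 R (nseq n j); lra.
  elim: n => [|n IH]; first by rewrite big_ord0 /= subrr.
  rewrite nseqS_cat inv_word_cat big_ord_recr /=.
  rewrite cyl_cat_sub; move: IH; set Z := \sum_(_ < _) _.
  have : inv_word (nseq n j) (inv_word [:: j] 1) <= inv_word (nseq n j) (inv_word [:: e] 0) by rewrite inv_word_mono /= inv_sep.
  have : inv_word (nseq n j) (inv_word [:: e] 1) <= inv_word (nseq n j) 1.
    by rewrite inv_word_mono; have /andP[] := inv_word1_01 R [:: e].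
  by lra.
Qed.

Lemma sumcyl_run n j e w :
  sumcyl (nseq n j ++ e :: w) = \sum_(i < n.+1) cyl (nseq i j ++ e :: w) + sumcyl w.
Proof.
elim: n => [|n IH]; first by rewrite big_ord1.
by rewrite big_ord_recr /= [cyl _ + _]addrC addrAC -IH addrC.
Qed.

(** [run_sum] is used twice: it bounds the distortion along the run by exp 432, and then the sum of
    the cylinders continued by [w] by exp 432 times [cyl w]. *)
Lemma sumcyl_run_le n j e w : e != j ->
  sumcyl (nseq n j ++ e :: w) <= expR 432 * cyl w + sumcyl w.
Proof.
move=> ej; rewrite sumcyl_run lerD2r.
apply: (@le_trans _ _ (\sum_(i < n.+1) expR 432 * cyl w * cyl (nseq i j ++ [:: e]))).
  apply: ler_sum => i _; rewrite -[e :: w]/([:: e] ++ w) catA.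
  apply: le_trans (cyl_cat_le _ _) _.
  rewrite -[leRHS]mulrA [X in _ <= _ * X]mulrC ler_wpM2r//.
    by rewrite mulr_ge0// ltW ?cyl_gt0.
  rewrite ler_expR ler_piMr ?ler0n// sumcyl_run addr0.
  exact: run_sum.
rewrite -big_distrr/= ler_piMr ?run_sum// mulr_ge0 ?expR_ge0//.
exact: ltW (cyl_gt0 _ _).
Qed.

Definition rho : R := 9 / 11.

(** The change of symbol puts [inv e z] at scaled squared distance at least 2 from the fixed point
    of [j]. Its preimage has a scaled squared distance v with v(1 + v)^2 >= 2, and v <= 2 then
    forces v >= 2/9. *)
Lemma dev_ge j e z : e != j -> 0 <= z <= 1 -> 2 / 9 <= cubic_coef R j * (inv j (inv e z) - xi R j) ^+ 2.
Proof.
move=> ej z01.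
have /inv_dev := inv_01 e z01 => /(_ j).
have : 2 <= cubic_coef R j * (inv e z - xi R j) ^+ 2.
  have /andP[] := inv_bnd e z01.
  by elim/ord3_ind: e ej; elim/ord3_ind: j => //= _ h1 h2; rewrite /cubic_coef /xi /=; nra.
have : inv e z - xi R j = (inv j (inv e z) - xi R j) * (1 + cubic_coef R j * (inv j (inv e z) - xi R j) ^+ 2).
  by rewrite -{1}(invK j (inv e z)) /fwd; ring.
move: (inv j (inv e z) - xi R j) => t ->.
have v0 : 0 <= cubic_coef R j * t ^+ 2.
  by rewrite mulr_ge0 ?exprn_even_ge0// ltW ?cubic_coef_gt0.
rewrite exprMn mulrA.
move: (cubic_coef R j * t ^+ 2) v0 => v v0 h v2.
rewrite leNgt; apply/negP => vl.
have : (1 + v) ^+ 2 <= 9 by nra.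
have : 0 <= (1 + v) ^+ 2 by nra.
by move: ((1 + v) ^+ 2) h => u; nra.
Qed.

(* The symbol before a change is read away from its fixed point, where the
   derivative is at least 11/9. *)
Lemma cyl_digit_le n j e w : e != j -> cyl (nseq n.+1 j ++ e :: w) <= rho * cyl w.
Proof.
move=> ej; rewrite nseqS_cat -catA; apply: le_trans (cyl_catl_le _ _ _) _.
have h0 := @dev_ge j e _ ej (inv_word0_01 R w); have h1 := @dev_ge j e _ ej (inv_word1_01 R w).
have := cyl_cons R j (e :: w); have := cyl_cons_le R e w.
have := cyl_gt0 R ([:: j] ++ e :: w).
rewrite /qf [inv_word (j :: e :: w) 0]/(inv j (inv e (inv_word w 0))) [inv_word (j :: e :: w) 1]/(inv j (inv e (inv_word w 1))).
rewrite -[j :: e :: w]/([:: j] ++ e :: w) /rho.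
move: h0 h1; move: (inv j _ - _) (inv j _ - _) => t u.
move: (cyl ([:: j] ++ e :: w)) (cyl (e :: w)) (cyl w) => X Y Z ht hu X0 YZ XY.
have : 11 / 9 <= 1 + cubic_coef R j * (u ^+ 2 + u * t + t ^+ 2).
  have c0 := cubic_coef_gt0 R j.
  have : 0 <= cubic_coef R j * (t + u) ^+ 2 by rewrite mulr_ge0 ?sqr_ge0 ?ltW.
  by nra.
by move: (1 + _) XY => q; nra.
Qed.

End Distortion.

(** * Words of digits: uniform contraction, uniform distortion, separation *)

Definition digit := ('I_3 * nat * 'I_3)%type.
(** The stored length is one less than that of the run, so no run is empty; under [digit_ok] these
    words form a prefix code. *)
Definition digit_word (d : digit) : seq 'I_3 := nseq d.1.2.+1 d.1.1 ++ [:: d.2].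
Definition digit_ok (d : digit) := d.2 != d.1.1.
Definition word (ds : seq digit) : seq 'I_3 := flatten (map digit_word ds).
Arguments word : simpl never.
Arguments digit_word : simpl never.

Lemma word_cons d ds : word (d :: ds) = digit_word d ++ word ds. Proof. by []. Qed.

Lemma word_cat ds ds' : word (ds ++ ds') = word ds ++ word ds'.
Proof. by rewrite /word map_cat flatten_cat. Qed.

Lemma word_rcons ds d : word (rcons ds d) = word ds ++ digit_word d.
Proof. by rewrite -cats1 word_cat /word /= cats0. Qed.

Section Digits.
Variable R : realType.
Implicit Types (s j e : 'I_3) (x y z : R) (w v : seq 'I_3) (d : digit) (ds : seq digit).
Local Notation inv_word := (@inv_word R).
Local Notation cyl := (@cyl R).
Local Notation rho := (rho R).

Lemma cyl_word_le ds : all digit_ok ds -> cyl (word ds) <= rho ^+ size ds.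
Proof.
elim: ds => [|d ds IH]; first by rewrite cyl0 expr0.
move=> /andP[dok /IH {}IH]; rewrite word_cons /digit_word -catA exprS.
apply: le_trans (cyl_digit_le _ _ _ dok) _.
by rewrite ler_wpM2l// /rho; lra.
Qed.

(** A geometric series with 11/2 = 1/(1 - [rho]). The finite partial sum is kept in the bound
    because the induction closes only with it. *)
Lemma sumcyl_word ds : all digit_ok ds ->
  sumcyl R (word ds) <= expR 432 * (11 / 2 * (1 - rho ^+ size ds)).
Proof.
elim: ds => [|d ds IH]; first by rewrite expr0 subrr !mulr0.
move=> /andP[dok dsok]; rewrite word_cons /digit_word -catA.
apply: le_trans (sumcyl_run_le _ _ _ dok) _.
have := cyl_word_le dsok; have := IH dsok; rewrite exprS.
have := expR_ge0 (432 : R); rewrite /rho.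
move: (expR _) (sumcyl _ _) (cyl _) (_ ^+ _) => E S X r E0 h1 h2.
by nra.
Qed.

Definition dist_const : R := expR (432 * (expR 432 * (11 / 2))).

Lemma dist_const_gt0 : 0 < dist_const. Proof. exact: expR_gt0. Qed.

Lemma dist_const_ge1 : 1 <= dist_const.
Proof. by rewrite -expR0 ler_expR !mulr_ge0 ?expR_ge0. Qed.

Lemma expR_sumcyl ds : all digit_ok ds -> expR (432 * sumcyl R (word ds)) <= dist_const.
Proof.
move=> dsok; rewrite ler_expR ler_wpM2l//; apply: le_trans (sumcyl_word dsok) _.
rewrite ler_wpM2l ?expR_ge0// ler_piMr// gerBl exprn_ge0//.
by rewrite /rho; lra.
Qed.

Lemma cyl_word_cat_le ds v : all digit_ok ds ->
  cyl (word ds ++ v) <= dist_const * (cyl (word ds) * cyl v).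
Proof.
move=> dsok; apply: le_trans (cyl_cat_le _ _ _) _.
by rewrite ler_wpM2r ?expR_sumcyl// mulr_ge0 ?(ltW (cyl_gt0 _ _)).
Qed.

Lemma cyl_word_cat_ge ds v : all digit_ok ds ->
  cyl (word ds) * cyl v <= dist_const * cyl (word ds ++ v).
Proof.
move=> dsok; apply: le_trans (cyl_cat_ge _ _ _) _.
by rewrite ler_wpM2r ?expR_sumcyl// (ltW (cyl_gt0 _ _)).
Qed.

Definition digits L : seq digit :=
  [seq d <- [seq (jl, e) | jl <- [seq (j, l) | j <- enum 'I_3, l <- iota 0 L], e <- enum 'I_3]
  | digit_ok d].

Lemma mem_digits L d : (d \in digits L) = digit_ok d && (d.1.2 < L)%N.
Proof.
rewrite mem_filter; case: d => [[j l] e]; congr (_ && _).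
apply/idP/idP => [/allpairsP[[jl e'] [/allpairsP[[j' l'] [_ /= + ->]] _ [_ -> _]]]|/= lL].
  by rewrite mem_iota.
by rewrite allpairs_f ?mem_enum// allpairs_f ?mem_enum// mem_iota.
Qed.

Lemma digits_uniq L : uniq (digits L).
Proof.
apply: filter_uniq; rewrite allpairs_uniq ?enum_uniq//; last by move=> [? ?] [? ?].
by rewrite allpairs_uniq ?enum_uniq ?iota_uniq// => -[? ?] [? ?].
Qed.

Lemma big_digits L (F : digit -> R) :
  \sum_(d <- digits L) F d =
  \sum_(j < 3) \sum_(l < L) \sum_(e < 3 | e != j) F (j, nat_of_ord l, e).
Proof.
rewrite big_filter big_mkcond/= big_allpairs_dep/= big_allpairs_dep/= big_enum/=.
apply: eq_bigr => j _; rewrite (_ : iota 0 L = index_iota 0 L); last by rewrite /index_iota subn0.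
rewrite big_mkord; apply: eq_bigr => l _; rewrite big_enum/=.
by rewrite [RHS]big_mkcond.
Qed.

(** Raising [L] by one splits the pending run of each symbol into its two changes of symbol, which
    become new digits, and the run longer by one. *)
Lemma cyl_digits L w :
  cyl w = \sum_(d <- digits L) cyl (w ++ digit_word d) + \sum_(j < 3) cyl (w ++ nseq L.+1 j).
Proof.
rewrite big_digits; elim: L => [|L IH].
  rewrite [X in X + _]big1 ?add0r; last by move=> j _; rewrite big_ord0.
  exact: cyl_split.
rewrite IH -!big_split/=; apply: eq_bigr => j _.
rewrite big_ord_recr/= -addrA; congr (_ + _).
rewrite cyl_split (bigD1 j)//= addrC; congr (_ + _); last first.
  by rewrite -catA -[j :: nseq L j]/(nseq L.+1 j) -nseqS_cat.
by apply: eq_bigr => e _; rewrite -catA.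
Qed.

Fixpoint Dpow L r : seq (seq digit) :=
  if r is r'.+1 then [seq rcons ds d | ds <- Dpow L r', d <- digits L] else [:: [::]].

Lemma mem_Dpow L r ds : ds \in Dpow L r ->
  [/\ size ds = r, all digit_ok ds & all (fun d => d.1.2 < L)%N ds].
Proof.
elim: r ds => [|r IH] ds /=; first by rewrite inE => /eqP ->.
move=> /allpairsP[[ds' d] /= [/IH[sz ok lt] + ->]].
by rewrite mem_digits => /andP[okdd ltd]; rewrite size_rcons sz !all_rcons ok lt okdd ltd.
Qed.

Lemma Dpow_uniq L r : uniq (Dpow L r).
Proof.
elim: r => //= r IH; rewrite allpairs_uniq ?digits_uniq//.
by move=> [a b] [c d] _ _ /= /rcons_inj[-> ->].
Qed.

(** At each digit the three overlong runs discard at most the fraction [3 * dist_const * eps] of the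
    current cylinder, uniformly by bounded distortion. A large [L] thus brings the normalisation of
    the free words close to 1 per digit. *)
Lemma Dpow_sum_ge L r (eps : R) : (forall j, cyl (nseq L.+1 j) <= eps) ->
  3 * dist_const * eps <= 1 -> (1 - 3 * dist_const * eps) ^+ r <= \sum_(ds <- Dpow L r) cyl (word ds).
Proof.
move=> heps le1; elim: r => [|r IH]; first by rewrite expr0 big_seq1 cyl0.
rewrite exprSr big_allpairs_dep/=.
apply: (@le_trans _ _ (\sum_(ds <- Dpow L r) cyl (word ds) * (1 - 3 * dist_const * eps))).
  by rewrite -big_distrl/= ler_wpM2r// subr_ge0.
rewrite big_seq [leRHS]big_seq; apply: ler_sum => ds /mem_Dpow[_ ok _].
under eq_bigr do rewrite word_rcons.
have e := cyl_digits L (word ds).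
have hA : \sum_(j < 3) cyl (word ds ++ nseq L.+1 j) <= 3 * (dist_const * (cyl (word ds) * eps)).
  rewrite [leRHS](_ : _ = \sum_(j < 3) dist_const * (cyl (word ds) * eps)); last first.
    by rewrite sumr_const card_ord mulr_natl.
  apply: ler_sum => j _; apply: le_trans (cyl_word_cat_le _ ok) _.
  by rewrite ler_wpM2l ?(ltW dist_const_gt0)// ler_wpM2l ?(ltW (cyl_gt0 _ _)).
by rewrite mulrBr mulr1; lra.
Qed.

Definition sep w v := inv_word w 1 <= inv_word v 0 \/ inv_word v 1 <= inv_word w 0.

Lemma sep_cat u w v : sep w v -> sep (u ++ w) (u ++ v).
Proof. by rewrite /sep !inv_word_cat !inv_word_mono. Qed.

Lemma sep_sym w v : sep w v -> sep v w. Proof. by case; [right|left]. Qed.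

Lemma sep_head s s' w v : s != s' -> sep (s :: w) (s' :: v).
Proof.
wlog lt : s s' w v / (s < s')%N => [hw|_].
  move=> ss'; have [lt|gt] : (s < s')%N \/ (s' < s)%N by apply/orP; rewrite -neq_ltn.
    exact: hw.
  by apply: sep_sym; apply: hw => //; rewrite eq_sym.
left => /=; apply: (@le_trans _ _ (inv s 1)).
  by rewrite inv_mono; have /andP[] := inv_word1_01 R w.
apply: le_trans (inv_sep _ lt) _.
by rewrite inv_mono; have /andP[] := inv_word0_01 R v.
Qed.

Lemma sep_digit d d' w v : digit_ok d -> digit_ok d' -> d != d' -> sep (digit_word d ++ w) (digit_word d' ++ v).
Proof.
case: d d' => [[j l] e] [[j' l'] e']; rewrite /digit_ok /digit_word /= => ej ej'.
have [jj'|jj'] := eqVneq j j'; last by move=> _; exact: sep_head.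
subst j'.
wlog ll : l l' e e' w v ej ej' / (l <= l')%N => [hw|].
  move=> h; have [ll|ll] := leqP l l'; first exact: hw.
  by apply: sep_sym; apply: hw => //; [exact: ltnW|rewrite eq_sym].
rewrite -!catA -![j :: nseq _ _ ++ _]/(nseq _.+1 j ++ _) => h.
have -> : nseq l'.+1 j = nseq l.+1 j ++ nseq (l' - l) j by rewrite -nseqD addSn subnKC.
rewrite -catA; apply: sep_cat.
move: ll; rewrite leq_eqVlt => /predU1P[el|lt].
  subst l'; rewrite subnn /=; apply: sep_head; apply: contra h => /eqP ->; exact: eqxx.
by rewrite -(subnSK lt) /=; exact: sep_head.
Qed.

Lemma sep_word ds ds' w v : size ds = size ds' -> all digit_ok ds -> all digit_ok ds' -> ds != ds' ->
  sep (word ds ++ w) (word ds' ++ v).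
Proof.
elim: ds ds' => [|d ds IH] [|d' ds']// [sz] /andP[ok1 ok2] /andP[ok1' ok2'].
rewrite !word_cons -(catA (digit_word d)) -(catA (digit_word d')); have [<-{d' ok1'}|dd' _] := eqVneq d d'; last exact: sep_digit.
by rewrite eqseq_cons eqxx => ne; apply: sep_cat; exact: IH.
Qed.

End Digits.

(** * Coded points and empirical averages *)

Section Coding.
Variable R : realType.
Implicit Types (s j e : 'I_3) (x y z : R) (w v : seq 'I_3).
Local Notation inv_word := (@inv_word R).
Local Notation cyl := (@cyl R).
Local Notation f := (@Defs.fmap R).

Lemma inv_01_lt s z : 0 < z < 1 -> 0 < inv s z < 1.
Proof.
move=> /andP[z0 z1].
have h0 : s%:R / 3 < inv s z by rewrite -inv0 inv_smono.
have h1 : inv s z < s.+1%:R / 3 by rewrite -inv1 inv_smono.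
by elim/ord3_ind: s h0 h1 => /= h0 h1; apply/andP; split; lra.
Qed.

Lemma inv_word_01_lt w z : 0 < z < 1 -> 0 < inv_word w z < 1.
Proof. by move=> z01; elim: w => //= s w IH; apply: inv_01_lt. Qed.

(** The middle branch lands in [1/3, 2/3], away from 0 and 1, and every branch preserves the open
    interval. *)
Lemma inv_word_mid w z : s1 \in w -> 0 <= z <= 1 -> 0 < inv_word w z < 1.
Proof.
move=> + z01; elim: w => //= s w IH; rewrite inE => /predU1P[<-|/IH]; last exact: inv_01_lt.
have /andP[/= h1 h2] := inv_bnd s1 (inv_word_01 w z01).
by apply/andP; split; lra.
Qed.

Lemma iter_inv_word k w z : 0 < z < 1 -> (k <= size w)%N -> iter k f (inv_word w z) = inv_word (drop k w) z.
Proof.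
move=> z01; elim: k w => [|k IH] [|s w]//= kw.
by rewrite -iterS iterSr fmap_inv ?inv_word_01_lt// IH.
Qed.

(** Windows start at every time [k], so that [neutral_close] applies directly to a run found
    anywhere in the itinerary. *)
Definition coded x (om : nat -> 'I_3) := forall k m,
  exists2 z, 0 <= z <= 1 & iter k f x = inv_word (mkseq (fun i => om (k + i)%N) m) z.

Section Stages.
Variable B : nat -> seq digit.
Hypothesis B_mid : forall n, s1 \in word (B n).

Definition stages n : seq digit := flatten (mkseq B n).

Lemma stagesS n : stages n.+1 = stages n ++ B n.
Proof. by rewrite /stages mkseqS -cats1 flatten_cat /= cats0. Qed.

Lemma stages_prefix n m : (n <= m)%N -> exists v, word (stages m) = word (stages n) ++ v.
Proof.
move=> /subnK <-; elim: (m - n)%N => [|k [v e]]; first by exists [::]; rewrite cats0.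
by exists (v ++ word (B (k + n))); rewrite addSn stagesS word_cat e catA.
Qed.

Lemma stages_size n : (n <= size (word (stages n)))%N.
Proof.
elim: n => // n IH; rewrite stagesS word_cat size_cat -addn1 leq_add//.
by case: (word (B n)) (B_mid n).
Qed.

(** After [k.+1] nonempty stages more than [k] symbols are known, so the default [s0] is never
    read. *)
Definition sym k : 'I_3 := nth s0 (word (stages k.+1)) k.

Lemma symE n k : (k < size (word (stages n)))%N -> sym k = nth s0 (word (stages n)) k.
Proof.
move=> kn; rewrite /sym; have hk := stages_size k.+1.
have [le|lt] := leqP n k.+1.
  by have [v ->] := stages_prefix le; rewrite nth_cat kn.
by have [v ->] := stages_prefix (ltnW lt); rewrite nth_cat hk.
Qed.

Definition pt : R := sup [set inv_word (word (stages n)) 0 | n in [set: nat]].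

Lemma stages_nest n m : inv_word (word (stages n)) 0 <= inv_word (word (stages m)) 1.
Proof.
apply: (@le_trans _ _ (inv_word (word (stages (maxn n m))) 0)).
  have [v ->] := stages_prefix (leq_maxl n m).
  by rewrite inv_word_cat inv_word_mono; have /andP[] := inv_word0_01 R v.
have [v ->] := stages_prefix (leq_maxr n m).
by rewrite inv_word_cat inv_word_mono; have /andP[_] := inv_word0_01 R v.
Qed.

Lemma pt_in n : inv_word (word (stages n)) 0 <= pt <= inv_word (word (stages n)) 1.
Proof.
apply/andP; split.
  apply: ub_le_sup; last by exists n.
  by exists (inv_word (word (stages n)) 1) => _ [m _ <-]; exact: stages_nest.
apply: ge_sup; first by exists (inv_word (word (stages 0)) 0), 0%N.
by move=> _ [m _ <-]; exact: stages_nest.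
Qed.

(** One further stage contains [s1], which moves the remaining point from the closed to the open
    interval; this is what lets [iter_inv_word] follow the orbit. *)
Lemma pt_inv_word n : exists2 z, 0 < z < 1 & pt = inv_word (word (stages n)) z.
Proof.
have [z z01 e] := inv_word_cyl_fix (pt_in n.+1).
exists (inv_word (word (B n)) z); first exact: inv_word_mid.
by rewrite e stagesS word_cat inv_word_cat.
Qed.

Lemma coded_pt : coded pt sym.
Proof.
move=> k m; have [z z01 ->] := pt_inv_word (k + m).
have sz := stages_size (k + m).
set w := word _ in sz *.
rewrite iter_inv_word//; last exact: leq_trans (leq_addr _ _) sz.
have -> : mkseq (fun i => sym (k + i)) m = take m (drop k w).
  apply: (@eq_from_nth _ s0).
    by rewrite size_mkseq size_takel// size_drop leq_subRL ?(leq_trans (leq_addr m k))// addnC.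
  move=> i; rewrite size_mkseq => im; rewrite nth_mkseq// nth_take// nth_drop.
  by apply: symE; rewrite -/w (leq_trans _ sz)// ltn_add2l.
exists (inv_word (drop m (drop k w)) z); last by rewrite -inv_word_cat cat_take_drop.
by have /andP[h0 h1] := inv_word_01_lt (drop m (drop k w)) z01; rewrite !ltW.
Qed.

End Stages.

Section Statistics.
Variables (x : R) (om : nat -> 'I_3).
Hypothesis x_om : coded x om.

Lemma coded_01 k : 0 <= iter k f x <= 1.
Proof. by have [z z01 ->] := x_om k 0. Qed.

Definition changes N := (\sum_(k < N) (om k != om k.+1))%N.
Definition visits j N := (\sum_(k < N) (om k == j))%N.
Definition freq N : R * R * R :=
  ((visits s0 N)%:R / N%:R, (visits s1 N)%:R / N%:R, (visits s2 N)%:R / N%:R).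

Lemma coded_close k m : (\sum_(i < m) (om (k + i) != om (k + i).+1) = 0)%N ->
  m.+1%:R * (iter k f x - xi R (om k)) ^+ 2 <= 8^-1.
Proof.
move=> h; have {}h i : (i < m)%N -> om (k + i.+1)%N = om (k + i)%N.
  move=> im; apply/eqP; rewrite eq_sym addnS; apply: contraT => ne.
  by move: h; rewrite (bigD1 (Ordinal im))//= ne.
have [z z01 ->] := x_om k m.+1.
have -> : mkseq (fun i => om (k + i)%N) m.+1 = nseq m.+1 (om k).
  apply: (@eq_from_nth _ s0); first by rewrite size_mkseq size_nseq.
  move=> i; rewrite size_mkseq => im; rewrite nth_mkseq// nth_nseq im.
  elim: i im => [|i IH] im; first by rewrite addn0.
  by rewrite h// IH// ltnW.
exact: neutral_close.
Qed.

Lemma changes_shift i N : (\sum_(k < N) (om (k + i)%N != om (k + i).+1) <= changes N + i)%N.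
Proof.
have -> : (\sum_(k < N) (om (k + i)%N != om (k + i).+1) =
  \sum_(i <= k < N + i) (om k != om k.+1))%N.
  by rewrite -[in RHS](add0n i) big_addn add0n addnK big_mkord.
apply: (@leq_trans (\sum_(0 <= k < N + i) (om k != om k.+1))).
  by rewrite [leqRHS](big_cat_nat (n := i)) ?leq_addl//= leq_addl.
rewrite (big_cat_nat (n := N)) ?leq_addr//= /changes big_mkord leq_add2l.
rewrite -[leqRHS](addKn N) -[leqRHS]muln1 -sum_nat_const_nat.
by apply: leq_sum => k _; exact: leq_b1.
Qed.

Lemma emp_sum N (g : R -> R) :
  N%:R^-1 * \sum_(k < N) g (xi R (om k)) = nu_int (freq N) g.
Proof.
have -> : \sum_(k < N) g (xi R (om k)) = \sum_(j < 3) (visits j N)%:R * g (xi R j).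
  under [RHS]eq_bigr do rewrite /visits natr_sum big_distrl/=.
  rewrite exchange_big/=; apply: eq_bigr => k _.
  rewrite (bigD1 (om k))//= eqxx mul1r big1 ?addr0// => j jk.
  by rewrite eq_sym (negbTE jk) mul0r.
rewrite !big_ord_recl big_ord0 addr0 /nu_int /freq /=.
have -> : lift ord0 ord0 = s1 by apply: val_inj.
have -> : lift ord0 (lift ord0 ord0) = s2 by apply: val_inj.
have -> : ord0 = s0 by apply: val_inj.
have -> : xi R s0 = xi1 R by rewrite /xi mul0r.
have -> : xi R s1 = xi2 R by rewrite /xi mul1r.
have -> : xi R s2 = xi3 R by rewrite /xi /= divff.
by ring.
Qed.

Lemma continuous_01_bounded (g : R -> R) : {within `[0, 1], continuous g} ->
  exists2 M : R, 0 < M & forall y, 0 <= y <= 1 -> `|g y| <= M.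
Proof.
move=> gc.
have [c1 _ h1] := @EVT_max R g 0 1 ler01 gc.
have [c2 _ h2] := @EVT_min R g 0 1 ler01 gc.
exists (`|g c1| + `|g c2| + 1).
  by rewrite ltr_wpDl// addr_ge0.
move=> y y01; have := h1 y; have := h2 y; rewrite in_itv/= => /(_ y01) a /(_ y01) b.
have := ler_norm (g c1); have := ler_norm (- g c2); rewrite normrN => a' b'.
by have := normr_ge0 (g c1); have := normr_ge0 (g c2); rewrite ler_norml => *; apply/andP; split; lra.
Qed.

Lemma continuous_01_at (g : R -> R) (a e : R) : {within `[0, 1], continuous g} -> 0 <= a <= 1 ->
  0 < e -> exists d : R, 0 < d /\ forall y, 0 <= y <= 1 -> `|y - a| < d -> `|g y - g a| <= e.
Proof.
move=> /continuous_within_itvP; move=> /(_ ltr01)[ci c0 c1] /andP[a0 a1] e0.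
have loc (y : R) : y = a -> g @ y --> g y ->
    exists d : R, 0 < d /\ forall y, 0 <= y <= 1 -> `|y - a| < d -> `|g y - g a| <= e.
  move=> -> /cvgrPdist_le /(_ e e0); move=> /nbhs_ballP[d /= d0 hd].
  exists d; split => // y' _ yd; rewrite distrC; apply: hd.
  rewrite -ball_normE /ball_ /=.  by rewrite distrC.
case: (ltgtP 0 a) a0 => // [a0|a0] _; case: (ltgtP a 1) a1 => // [a1|a1] _.
- by apply: (loc a) => //; apply: ci; rewrite in_itv/= a0.
- move: c1 => /cvgrPdist_le /(_ e e0); move=> /nbhs_ballP[d /= d0 hd].
  exists d; split => // y /andP[y0 y1] yd; rewrite a1 in yd *.
  have [->|yn] := eqVneq y 1; first by rewrite subrr normr0 ltW.
  by rewrite distrC; apply: hd; [rewrite -ball_normE /ball_ /= distrC|rewrite lt_neqAle yn].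
- move: c0 => /cvgrPdist_le /(_ e e0); move=> /nbhs_ballP[d /= d0 hd].
  exists d; split => // y /andP[y0 y1] yd; rewrite -a0 in yd *.
  have [->|yn] := eqVneq y 0; first by rewrite subrr normr0 ltW.
  by rewrite distrC; apply: hd; [rewrite -ball_normE /ball_ /= distrC|rewrite lt_neqAle eq_sym yn].
- by exfalso; move: a0 a1 => <- /eqP; rewrite eq_sym oner_eq0.
Qed.

Hypothesis few_changes : forall e : R, 0 < e ->
  exists N0, forall N, (N0 <= N)%N -> (changes N)%:R <= e * N%:R.

(** Times are sorted by whether a change of symbol occurs within the next [m] steps. If none does,
    the orbit point is within [d] of the fixed point of its symbol; otherwise the error is at most
    2M, and such times are rare because each change lies in at most [m] windows. *)
Lemma emp_close (g : R -> R) (e : R) : {within `[0, 1], continuous g} -> 0 < e ->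
  exists N0, forall N, (N0 <= N)%N -> `|emp_avg N x g - nu_int (freq N) g| <= e.
Proof.
move=> gc e0.
have [M M0 gM] := continuous_01_bounded gc.
have e2 : 0 < e / 2 by lra.
have [d d0 hd] : exists2 d : R, 0 < d & forall j y, 0 <= y <= 1 -> `|y - xi R j| < d ->
    `|g y - g (xi R j)| <= e / 2.
  have [d h] := choice (fun j => continuous_01_at gc (xi_01 R j) e2).
  exists (Num.min (d s0) (Num.min (d s1) (d s2))); first by rewrite !lt_min; have [? _] := h s0; have [? _] := h s1; have [? _] := h s2; apply/and3P.
  move=> j y y01; have [_ {}h] := h j; rewrite !lt_min => /and3P[h0 h1 h2].
  have hi i : `|y - xi R j| < d i by elim/ord3_ind: i.
  exact: h.
have [m hm] : exists m : nat, 8^-1 < m.+1%:R * d ^+ 2.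
  exists (Num.truncn (8^-1 / d ^+ 2)).
  rewrite -ltr_pdivrMr ?exprn_gt0//; apply: truncnS_gt.
pose bad k := (\sum_(i < m) (om (k + i) != om (k + i).+1))%N.
have term k : `|g (iter k f x) - g (xi R (om k))| <= e / 2 + 2 * M * (bad k)%:R.
  have [b0|b0] := posnP (bad k).
    rewrite b0 mulr0 addr0; apply: hd (coded_01 k) _.
    rewrite -(@ltr_pXn2r _ 2)// ?nnegrE//; last exact: ltW.
    rewrite real_normK ?num_real//.
    have cc := @coded_close k m b0.
    rewrite -(ltr_pM2l (ltr0Sn R m)). exact: le_lt_trans cc hm.
  apply: (@le_trans _ _ (M + M)).
    by apply: le_trans (ler_normB _ _) _; rewrite lerD ?gM ?coded_01 ?xi_01.
  have : 1 <= (bad k)%:R :> R by rewrite ler1n.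
  by nra.
have sumbad N : (\sum_(k < N) bad k <= m * (changes N + m))%N.
  rewrite /bad exchange_big/= -[X in (_ <= X * _)%N](card_ord m) -sum_nat_const.
  by apply: leq_sum => i _; apply: leq_trans (changes_shift i N) _; rewrite leq_add2l ltnW.
(* The total error is at most e/2 * N + D * (changes + m); the thresholds below make the
   contributions of the changes and of m at most e/4 * N each. *)
pose D := 2 * M * m.+1%:R.
have D0 : 0 < D by rewrite !mulr_gt0.
have eD : 0 < e / (4 * D) by rewrite divr_gt0// mulr_gt0.
have [N1 hN1] := few_changes eD.
exists (maxn N1 (Num.truncn (4 * D * m%:R / e)).+1) => N; rewrite geq_max => /andP[NN1 Nm].
have N0 : 0 < N%:R :> R by rewrite ltr0n; exact: leq_ltn_trans Nm.
have {}hN := hN1 N NN1.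
have hm' : 4 * D * m%:R <= e * N%:R.
  rewrite -ler_pdivrMl// mulrC; apply: ltW; apply: lt_le_trans (truncnS_gt _) _.
  by rewrite ler_nat.
rewrite /emp_avg -emp_sum -mulrBr -sumrB normrM ger0_norm ?invr_ge0//.
rewrite mulrC ler_pdivrMr//.
apply: le_trans (ler_norm_sum _ _ _) _.
apply: (@le_trans _ _ (\sum_(k < N) (e / 2 + 2 * M * (bad k)%:R))); first by apply: ler_sum.
rewrite big_split/= sumr_const card_ord -mulr_natr -big_distrr/= -natr_sum.
have : (\sum_(k < N) bad k)%N%:R <= m.+1%:R * ((changes N)%:R + m%:R) :> R.
  by rewrite -natrD -natrM ler_nat (leq_trans (sumbad N))// leq_mul2r leqnSn orbT.
have hc : D * (changes N)%:R <= e / 4 * N%:R.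
  have -> : e / 4 * N%:R = D * (e / (4 * D) * N%:R) by field; lra.
  by rewrite ler_wpM2l// ltW.
move: hc hm'; rewrite /D.
set S := (\sum_(k < N) bad k)%:R => hc hm' hS.
have M2 : 0 <= 2 * M by rewrite mulr_ge0// ltW.
have := ler_wpM2l M2 hS.
by lra.
Qed.

End Statistics.
End Coding.

(** * Measures on the neutral fixed points *)

Section Measure.
Variable R : realType.
Implicit Types (p q : R * R * R) (g : R -> R) (mu : probability R R).

Lemma prod3_norm_le p q (e : R) : `|p.1.1 - q.1.1| <= e -> `|p.1.2 - q.1.2| <= e ->
  `|p.2 - q.2| <= e -> `|p - q| <= e.
Proof. by move=> h1 h2 h3; rewrite !prod_normE /= !ge_max h1 h2. Qed.

Lemma prod3_norm_ge p q :
  [/\ `|p.1.1 - q.1.1| <= `|p - q|, `|p.1.2 - q.1.2| <= `|p - q| & `|p.2 - q.2| <= `|p - q|].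
Proof. by rewrite !prod_normE /= !le_max !lexx !orbT. Qed.

Lemma nu_int_dist g (M : R) p q : (forall j, `|g (xi R j)| <= M) ->
  `|nu_int p g - nu_int q g| <= 3 * M * `|p - q|.
Proof.
move=> gM; have [h1 h2 h3] := prod3_norm_ge p q.
have -> : nu_int p g - nu_int q g = (p.1.1 - q.1.1) * g (xi1 R) +
  (p.1.2 - q.1.2) * g (xi2 R) + (p.2 - q.2) * g (xi3 R) by rewrite /nu_int; ring.
have -> : 3 * M * `|p - q| = `|p - q| * M + `|p - q| * M + `|p - q| * M by ring.
have e1 : xi R s0 = xi1 R by rewrite /xi mul0r.
have e2 : xi R s1 = xi2 R by rewrite /xi mul1r.
have e3 : xi R s2 = xi3 R by rewrite /xi /= divff.
apply: le_trans (ler_normD _ _) _; apply: lerD.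
  apply: le_trans (ler_normD _ _) _; apply: lerD.
    by rewrite normrM ler_pM// -e1.
  by rewrite normrM ler_pM// -e2.
by rewrite normrM ler_pM// -e3.
Qed.

Definition I01 : set R := `[0%R, 1%R]%classic.
Definition xis : set R := [set xi1 R] `|` [set xi2 R] `|` [set xi3 R].

Lemma xi12 : xi1 R != xi2 R. Proof. by rewrite /xi1 /xi2 eq_sym invr_neq0. Qed.
Lemma xi13 : xi1 R != xi3 R. Proof. by rewrite /xi1 /xi3 eq_sym oner_neq0. Qed.
Lemma xi23 : xi2 R != xi3 R. Proof. by rewrite /xi2 /xi3 lt_eqF// invf_lt1// ltr1n. Qed.

Lemma measurable_I01 : measurable (I01 : set R). Proof. exact: measurable_itv. Qed.
#[local] Hint Resolve measurable_I01 : core.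

Lemma measurable_xis : measurable (xis : set R).
Proof. by rewrite /xis; apply: measurableU => //; apply: measurableU. Qed.

Lemma xis_sub : xis `<=` I01.
Proof.
rewrite /I01 => y [[]|] ->; rewrite /= in_itv/= /xi1 /xi2 /xi3 ?lexx ?ler01//.
by rewrite invr_ge0 ler0n invf_le1// ler1n.
Qed.

Lemma integrable_within mu g : {within I01, continuous g} ->
  mu.-integrable I01 (EFin \o g).
Proof.
move=> gc; apply: measurable_bounded_integrable => //.
- by rewrite -ge0_fin_numE// fin_num_measure.
- exact: subspace_continuous_measurable_fun.
- have [M M0 gM] := continuous_01_bounded gc.
  exists M; split; first exact: num_real.
  move=> M' MM' y /= y01; apply: le_trans (ltW MM'); apply: gM.
  by move: y01; rewrite /I01/= in_itv/=.
Qed.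

Lemma integral_single mu g a : I01 a -> {within I01, continuous g} ->
  (\int[mu]_(y in [set a]) (g y)%:E = (g a)%:E * mu [set a])%E.
Proof.
move=> a01 gc.
rewrite (eq_integral (cst (g a)%:E)); first by rewrite integral_cst.
by move=> y; rewrite inE /= => ->.
Qed.

Lemma integral_xis mu g : mu (~` xis) = 0%E -> {within I01, continuous g} ->
  (\int[mu]_(y in I01) (g y)%:E = (g (xi1 R))%:E * mu [set xi1 R] +
    (g (xi2 R))%:E * mu [set xi2 R] + (g (xi3 R))%:E * mu [set xi3 R])%E.
Proof.
move=> mu0 gc.
have mg : measurable_fun xis (EFin \o g).
  apply: (measurable_funS _ xis_sub) => //.
  by have /measurable_int := integrable_within mu gc.
have I1 : I01 (xi1 R) by apply: xis_sub; left; left.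
have I2 : I01 (xi2 R) by apply: xis_sub; left; right.
have I3 : I01 (xi3 R) by apply: xis_sub; right.
rewrite (@negligible_integral _ _ _ mu I01 (~` xis))//; last 2 first.
- by apply: measurableC; exact: measurable_xis.
- exact: integrable_within.
rewrite setDE setCK (_ : I01 `&` xis = xis); last by apply/setIidPr; exact: xis_sub.
rewrite /xis integral_setU//; last 2 first.
- exact: measurableU.
- apply/disj_set2P; apply/seteqP; split=> // y [[]/= -> /eqP].
    by rewrite (negbTE xi13).
  by rewrite (negbTE xi23).
rewrite integral_setU//; last 2 first.
- by apply: measurable_funS mg => //; [exact: measurable_xis|move=> y; left].
- by apply/disj_set2P; apply/seteqP; split=> // y [/= -> /eqP]; rewrite (negbTE xi12).
by rewrite !integral_single.
Qed.

Lemma mu_xis mu A : mu (~` xis) = 0%E -> measurable A ->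
  (mu A = mu [set xi1 R] * \d_(xi1 R) A + mu [set xi2 R] * \d_(xi2 R) A
    + mu [set xi3 R] * \d_(xi3 R) A)%E.
Proof.
move=> mu0 mA.
have muI a : (mu (A `&` [set a]) = mu [set a] * \d_a A)%E.
  rewrite diracE; have [aA|aA] := boolP (a \in A).
    rewrite mule1; congr (mu _); apply/setIidPr => y /= ->; exact: set_mem.
  rewrite mule0 (_ : A `&` [set a] = set0) ?measure0//.
  by apply/seteqP; split=> // y [/[swap] -> /mem_set]; rewrite (negbTE aA).
rewrite -!muI -measureU//; first last.
- apply/seteqP; split=> // y [[_ /= ->] [_ /= /eqP]]; by rewrite (negbTE xi12).
- exact: measurableI.
- exact: measurableI.
rewrite -setIUr -measureU//; first last.
- by apply/seteqP; split=> // y [[_ []/= ->] [_ /= /eqP]]; rewrite ?(negbTE xi13) ?(negbTE xi23).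
- exact: measurableI.
- by apply: measurableI => //; exact: measurableU.
rewrite -setIUr -/xis.
have mX := measurable_xis.
have e : mu A = (mu (A `\` xis) + mu (A `&` xis))%E := measureDI mu mA mX.
rewrite e [X in (X + _)%E](_ : _ = 0%E) ?add0e//.
apply/eqP; rewrite eq_le measure_ge0 andbT -mu0; apply: le_measure; rewrite ?inE.
- exact: measurableD.
- exact: measurableC.
- by move=> y [].
Qed.

Lemma nu_mass mu p : (forall A, measurable A -> mu A = nu p A) ->
  [/\ mu (~` xis) = 0%E, mu [set xi1 R] = p.1.1%:E,
     mu [set xi2 R] = p.1.2%:E & mu [set xi3 R] = p.2%:E].
Proof.
have nxi : (xi1 R \in ~` xis) = false /\ (xi2 R \in ~` xis) = false /\ (xi3 R \in ~` xis) = false.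
  by split; [|split]; apply/negbTE; rewrite notin_setE => h; apply: h; [left; left|left; right|right].
have [e12 e13 e23] := And3 (negbTE xi12) (negbTE xi13) (negbTE xi23).
have [e21 e31 e32] : [/\ (xi2 R == xi1 R) = false, (xi3 R == xi1 R) = false & (xi3 R == xi2 R) = false].
  by rewrite ![xi3 R == _]eq_sym [xi2 R == _]eq_sym.
have mC : measurable (~` xis : set R) by apply: measurableC; exact: measurable_xis.
move=> h; split; rewrite h// /nu !diracE.
- by case: nxi => -> [-> ->]; rewrite !mule0 !adde0.
- by rewrite !classical_sets.in_set1 eqxx e21 e31 mule1 !mule0 !adde0.
- by rewrite !classical_sets.in_set1 eqxx e12 e32 mule1 !mule0 adde0 add0e.
- by rewrite !classical_sets.in_set1 eqxx e13 e23 mule1 !mule0 !add0e.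
Qed.

Lemma integral_nu mu p g : (forall A, measurable A -> mu A = nu p A) ->
  {within I01, continuous g} -> (\int[mu]_(y in I01) (g y)%:E = (nu_int p g)%:E)%E.
Proof.
move=> /nu_mass[h0 h1 h2 h3] gc; rewrite integral_xis// h1 h2 h3 -!EFinM -!EFinD.
by congr _%:E; rewrite /nu_int; ring.
Qed.

Lemma horner_within (P : {poly R}) : {within I01, continuous (horner P)}.
Proof. by apply: continuous_subspaceT; exact: continuous_horner. Qed.

(** The polynomial y(1 - y)(y - 1/2)^2 is nonnegative on [0, 1] and vanishes there only at the three
    fixed points, so its zero integral concentrates [mu] on them. The Lagrange quadratics of the
    three points then read off the masses. *)
Lemma nu_of_integrals mu p :
  (forall g, {within I01, continuous g} ->
    (\int[mu]_(y in I01) (g y)%:E = (nu_int p g)%:E)%E) ->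
  p.1.1 + p.1.2 + p.2 = 1 ->
  forall A, measurable A -> mu A = nu p A.
Proof.
move=> hg p1.
pose P0 : {poly R} := 'X * (1 - 'X) * ('X - (2^-1)%:P) ^+ 2.
have P0E y : P0.[y] = y * (1 - y) * (y - 2^-1) ^+ 2 by rewrite /P0 !hornerE.
have I01E y : I01 y = (0 <= y <= 1) :> Prop by rewrite /I01 /= in_itv.
have mI : measurable (I01 : set R) by exact: measurable_itv.
(* The test integrals do not see the part of [mu] outside [0, 1]; testing the constant 1 shows that
   there is none. *)
have mu1 : mu I01 = 1%E.
  have := hg (cst 1); rewrite (eq_integral (cst 1%:E))// integral_cst// mul1e => ->.
    by congr _%:E; rewrite /nu_int /= !mulr1.
  by apply: continuous_subspaceT => y; exact: cst_continuous.
have mu0 : mu (~` xis) = 0%E.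
  have int0 : (\int[mu]_(y in I01) `|(P0.[y])%:E| = 0)%E.
    rewrite (eq_integral (fun y => (P0.[y])%:E)); last first.
      move=> y; rewrite inE I01E => /andP[y0 y1]; rewrite gee0_abs// lee_fin P0E.
      by rewrite mulr_ge0 ?exprn_even_ge0// mulr_ge0// subr_ge0.
    rewrite hg; last exact: horner_within.
    rewrite /nu_int !P0E /xi1 /xi2 /xi3; congr _%:E.
    by rewrite !subrr expr0n !(mulr0, mul0r) !addr0.
  have mP : measurable_fun I01 (fun y => (P0.[y])%:E).
    by have /measurable_int := integrable_within mu (@horner_within P0).
  have /ae_eq_integral_abs := int0; move=> /(_ mI mP)[N [mN N0 hN]].
  have sub : ~` xis `<=` N `|` ~` I01.
    move=> y ny; have [y01|] := pselect (I01 y); last by right.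
    left; apply: hN => /= /(_ y01) [] /eqP; rewrite P0E mulf_eq0 sqrf_eq0 mulf_eq0 !subr_eq0.
    by move=> /orP[/orP[/eqP|/eqP]|/eqP] e; apply: ny; rewrite -?e ?e; [left; left|right|left; right].
  apply/eqP; rewrite eq_le measure_ge0 andbT.
  have mC : mu (~` I01) = 0%E by rewrite probability_setC// mu1 subee.
  apply: (@le_trans _ _ (mu (N `|` ~` I01))).
    apply: le_measure; rewrite ?inE//; first by apply: measurableC; exact: measurable_xis.
    by apply: measurableU => //; exact: measurableC.
  have : (mu (N `|` ~` I01) <= mu N + mu (~` I01))%E.
    by apply: measureU2 => //; exact: measurableC.
  by rewrite mC adde0 [X in (_ <= X)%E](_ : _ = 0%E).
have test (P : {poly R}) := etrans (esym (integral_xis mu0 (@horner_within P))) (hg _ (@horner_within P)).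
have e1 : mu [set xi1 R] = p.1.1%:E.
  have := test (2%:P * ('X - 1%:P) * ('X - (2^-1)%:P)); rewrite /nu_int.
  rewrite (_ : _.[xi1 R] = 1); last by rewrite !hornerE /xi1; field.
  rewrite (_ : _.[xi2 R] = 0); last by rewrite !hornerE /xi2; field.
  rewrite (_ : _.[xi3 R] = 0); last by rewrite !hornerE /xi3; field.
  by rewrite !(mul0e, mul1e, mulr0, mulr1, addr0, adde0, add0r, add0e).
have e2 : mu [set xi2 R] = p.1.2%:E.
  have := test (4%:P * 'X * (1%:P - 'X)); rewrite /nu_int.
  rewrite (_ : _.[xi1 R] = 0); last by rewrite !hornerE /xi1; field.
  rewrite (_ : _.[xi2 R] = 1); last by rewrite !hornerE /xi2; field.
  rewrite (_ : _.[xi3 R] = 0); last by rewrite !hornerE /xi3; field.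
  by rewrite !(mul0e, mul1e, mulr0, mulr1, addr0, adde0, add0r, add0e).
have e3 : mu [set xi3 R] = p.2%:E.
  have := test (2%:P * 'X * ('X - (2^-1)%:P)); rewrite /nu_int.
  rewrite (_ : _.[xi1 R] = 0); last by rewrite !hornerE /xi1; field.
  rewrite (_ : _.[xi2 R] = 0); last by rewrite !hornerE /xi2; field.
  rewrite (_ : _.[xi3 R] = 1); last by rewrite !hornerE /xi3; field.
  by rewrite !(mul0e, mul1e, mulr0, mulr1, addr0, adde0, add0r, add0e).
by move=> A mA; rewrite (mu_xis mu0 mA) e1 e2 e3.
Qed.

End Measure.

(** * Weak limit points of the empirical measures in terms of symbol frequencies *)

Section LimitPoints.
Variables (R : realType) (x : R) (om : nat -> 'I_3).
Hypothesis x_om : coded x om.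
Hypothesis few_changes : forall e : R, 0 < e ->
  exists N0, forall N, (N0 <= N)%N -> (changes om N)%:R <= e * N%:R.
Local Notation freq := (@freq R om).

Lemma emp_cvg_freq (phi : nat -> nat) p (g : R -> R) : (forall k, (k <= phi k)%N) ->
  (forall e : R, 0 < e -> exists K, forall k, (K <= k)%N -> `|freq (phi k) - p| <= e) ->
  {within `[0, 1], continuous g} ->
  (fun k => emp_avg (phi k) x g) @ \oo --> nu_int p g.
Proof.
move=> phik cp gc; apply/cvgrPdist_le => e e0.
have [M M0 gM] := continuous_01_bounded gc.
have e2 : 0 < e / 2 by lra.
have [N0 hN] := emp_close x_om few_changes gc e2.
have e6 : 0 < e / (6 * M) by rewrite divr_gt0// mulr_gt0.
have [K hK] := cp _ e6.
exists (maxn N0 K) => // k /=; rewrite geq_max => /andP[N0k Kk].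
have h1 := hN _ (leq_trans N0k (phik k)); have h2 := hK _ Kk.
have h3 : `|nu_int (freq (phi k)) g - nu_int p g| <= e / 2.
  apply: (@le_trans _ _ (3 * M * `|freq (phi k) - p|)).
    by apply: nu_int_dist => j; exact: gM (xi_01 _ _).
  have -> : e / 2 = 3 * M * (e / (6 * M)) by field; rewrite gt_eqF.
  by rewrite ler_wpM2l// mulr_ge0// ltW.
rewrite distrC -(subrK (nu_int (freq (phi k)) g) (emp_avg _ _ _)) -addrA.
by apply: le_trans (ler_normD _ _) _; lra.
Qed.

Lemma emp_avg_coord (P : {poly R}) (e : R) : 0 < e -> exists N0, forall N, (N0 <= N)%N ->
  `|emp_avg N x (horner P) - nu_int (freq N) (horner P)| <= e.
Proof. by move=> e0; apply: emp_close => //; exact: horner_within. Qed.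

Lemma emp_cvg_to_freq p :
  (forall e : R, 0 < e -> exists K, forall k, (K <= k)%N -> `|freq k - p| <= e) ->
  emp_cvg_to x p.
Proof. by move=> cp g gc; exact: (emp_cvg_freq (phi := id)). Qed.

Variable C : set (R * R * R).
Hypothesis C_closed : closed C.
Hypothesis C_simplex : C `<=` @simplex R.
Hypothesis freq_near : forall e : R, 0 < e ->
  exists N0, forall N, (N0 <= N)%N -> exists2 q, C q & `|freq N - q| <= e.
Hypothesis freq_visits : forall p, C p -> forall e : R, 0 < e -> forall N0,
  exists2 N, (N0 <= N)%N & `|freq N - p| <= e.

Lemma increasing_ge (phi : nat -> nat) : (forall k, (phi k < phi k.+1)%N) -> forall k, (k <= phi k)%N.
Proof. by move=> h; elim=> // k /leq_ltn_trans; apply. Qed.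

Lemma limit_point_sufficient p (mu : probability R R) : C p ->
  (forall A, measurable A -> mu A = nu p A) -> weak_limit_point x mu.
Proof.
move=> Cp muE.
have step (kN : nat * nat) : exists N, (kN.2 < N)%N /\ `|freq N - p| <= kN.1.+1%:R^-1.
  have [|N NN hN] := freq_visits Cp (e := kN.1.+1%:R^-1) _ kN.2.+1; first by rewrite invr_gt0.
  by exists N.
have [nx nxP] := choice step.
pose phi := fix phi k := if k is k'.+1 then nx (k'.+1, phi k') else nx (0, 0)%N.
have phiS k : (phi k < phi k.+1)%N by have [] := nxP (k.+1, phi k).
have phip k : `|freq (phi k) - p| <= k.+1%:R^-1.
  case: k => [|k]; first by have [] := nxP (0, 0)%N.
  by have [] := nxP (k.+1, phi k).
exists phi; split=> // g gc; rewrite -/(@I01 R) (integral_nu muE)//.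
apply: cvg_EFin; first by exists 0%N.
apply: emp_cvg_freq => //; first exact: increasing_ge.
move=> e e0; exists (Num.truncn e^-1) => k Kk; apply: le_trans (phip k) _.
rewrite invf_ple ?posrE//; apply: ltW; apply: lt_le_trans (truncnS_gt _) _.
by rewrite ler_nat.
Qed.

(** Testing against the Lagrange quadratics of the fixed points turns weak convergence into
    convergence of the three frequencies. Their limit lies in [C] because [C] is closed, and
    uniqueness of limits identifies the integrals against [mu]. *)
Lemma limit_point_necessary (mu : probability R R) : weak_limit_point x mu ->
  exists2 p, C p & forall A, measurable A -> mu A = nu p A.
Proof.
move=> [phi [phiS hphi]].
have phik := increasing_ge phiS.
have coord (P : {poly R}) (c : nat -> R) : (forall N, nu_int (freq N) (horner P) = c N) ->
    exists l : R, forall e : R, 0 < e -> exists K, forall k, (K <= k)%N -> `|c (phi k) - l| <= e.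
  move=> hc; have := hphi _ (@horner_within R P).
  have /integrable_fin_num := integrable_within mu (@horner_within R P).
  move=> /(_ (@measurable_I01 R)) /= /fineK <-; set l := fine _ => /fine_cvgP[_ cl].
  exists l => e e0; have e2 : 0 < e / 2 by lra.
  have [N0 hN] := emp_avg_coord P e2.
  move/cvgrPdist_le: cl => /(_ _ e2) [K _ hK].
  exists (maxn N0 K) => k; rewrite geq_max => /andP[N0k Kk].
  have h1 := hN _ (leq_trans N0k (phik k)); have := hK _ Kk => /= h2.
  move: h1; rewrite hc => h1.
  rewrite -(subrK (emp_avg (phi k) x (horner P)) (c _)) -addrA.
  by apply: le_trans (ler_normD _ _) _; rewrite distrC (distrC _ l); lra.
have [l1 h1] := coord (2%:P * ('X - 1%:P) * ('X - (2^-1)%:P)) (fun N => (freq N).1.1) ltac:(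
  by move=> N; cbv beta; move: (freq N) => q; rewrite /nu_int !(hornerM, hornerD, hornerN, hornerX, hornerC) /xi1 /xi2 /xi3; field).
have [l2 h2] := coord (4%:P * 'X * (1%:P - 'X)) (fun N => (freq N).1.2) ltac:(
  by move=> N; cbv beta; move: (freq N) => q; rewrite /nu_int !(hornerM, hornerD, hornerN, hornerX, hornerC) /xi1 /xi2 /xi3; field).
have [l3 h3] := coord (2%:P * 'X * ('X - (2^-1)%:P)) (fun N => (freq N).2) ltac:(
  by move=> N; cbv beta; move: (freq N) => q; rewrite /nu_int !(hornerM, hornerD, hornerN, hornerX, hornerC) /xi1 /xi2 /xi3; field).
pose p := (l1, l2, l3) : R * R * R.
have cp e : 0 < e -> exists K, forall k, (K <= k)%N -> `|freq (phi k) - p| <= e.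
  move=> e0; have [K1 H1] := h1 _ e0; have [K2 H2] := h2 _ e0; have [K3 H3] := h3 _ e0.
  exists (maxn K1 (maxn K2 K3)) => k; rewrite !geq_max => /and3P[k1 k2 k3].
  by apply: prod3_norm_le; [exact: H1|exact: H2|exact: H3].
have Cp : C p.
  apply: C_closed => B /nbhs_ballP[e /= e0 hB].
  have e3 : 0 < e / 3 by lra.
  have [K hK] := cp _ e3; have [N0 hN] := freq_near e3.
  have [q Cq hq] := hN (phi (maxn N0 K)) (leq_trans (leq_maxl _ _) (phik _)).
  exists q; split=> //; apply: hB; rewrite -ball_normE /ball_ /=.
  have := hK (maxn N0 K) (leq_maxr _ _) => hp.
  rewrite -(subrK (freq (phi (maxn N0 K))) p) -addrA.
  by apply: le_lt_trans (ler_normD _ _) _; rewrite distrC; lra.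
exists p => //; apply: nu_of_integrals; last by have [] := C_simplex Cp.
move=> g gc; apply: (cvg_unique _ (hphi g gc)) => //=.
by apply: cvg_EFin; [exists 0%N|exact: emp_cvg_freq].
Qed.

Lemma V_of_freq : V_eq_piC x C.
Proof.
move=> mu; split; first exact: limit_point_necessary.
by move=> [p Cp hp]; exact: limit_point_sufficient hp.
Qed.

End LimitPoints.

(** * Mass distribution on a tree *)

Section Tree.
Variables (R : realType) (T : eqType) (t0 : T) (U : nat -> seq T) (p : nat -> T -> R).
Hypothesis U_uniq : forall n, uniq (U n).
Hypothesis p_ge0 : forall n u, 0 <= p n u.
Hypothesis p_sum : forall n, \sum_(u <- U n) p n u = 1.

Definition mass (w : seq T) : R := \prod_(i < size w) p i (nth t0 w i).

Lemma mass_ge0 w : 0 <= mass w.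
Proof. by apply: prodr_ge0. Qed.

Lemma mass_rcons w u : mass (rcons w u) = mass w * p (size w) u.
Proof.
rewrite /mass size_rcons big_ord_recr /= nth_rcons ltnn eqxx; congr (_ * _).
by apply: eq_bigr => i _; rewrite nth_rcons ltn_ord.
Qed.

(** Guarantees that a forbidden node is charged to at most one child, so passing to children does
    not increase the total load. *)
Lemma prefix_rcons_uniq w v (s : seq T) : uniq s ->
  (\sum_(u <- s) (prefix (rcons w u) v : nat) <= prefix w v)%N.
Proof.
move=> us; have [/prefixP[v' ->]|npre] := boolP (prefix w v); last first.
  rewrite big1_seq// => u _; apply/eqP; rewrite eqb0; apply: contra npre => /prefixP[v' ->].
  by rewrite -cats1 -catA prefix_prefix.
rewrite (eq_bigr (fun u => (u == head t0 v') && (v' != [::]) : nat)); last first.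
  move=> u _; rewrite -cats1 prefix_catr// eqxx /=; case: v' => [|a v']; first by rewrite andbF.
  by rewrite prefix_cons prefix0s !andbT.
case: v' => [|a v'] /=; first by rewrite big1// => u _; rewrite andbF.
under eq_bigr do rewrite andbT.
rewrite -big_mkcond/= sum1_count.
by rewrite (eq_count (a2 := pred1 a)) // count_uniq_mem// leq_b1.
Qed.

Variable ws : nat -> seq T.

(* The total mass of the forbidden nodes below [w]; it is < mass w at the root, and
   this inequality is inherited by at least one child. *)
Definition load (w : seq T) : \bar R :=
  (\sum_(0 <= i <oo) (if prefix w (ws i) then mass (ws i) else 0)%:E)%E.

(** Pigeonhole: the masses of the children add up to [mass w], their loads to at most [load w]. *)
Lemma load_child w : (load w < (mass w)%:E)%E ->
  exists2 u, u \in U (size w) & (load (rcons w u) < (mass (rcons w u))%:E)%E.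
Proof.
move=> lw; apply: contrapT => H.
have {}H u : u \in U (size w) -> ((mass (rcons w u))%:E <= load (rcons w u))%E.
  move=> uU; rewrite leNgt; apply/negP => h; apply: H; exists u => //.
move: lw; apply/negP; rewrite -leNgt.
have -> : mass w = \sum_(u <- U (size w)) mass (rcons w u).
  under eq_bigr do rewrite mass_rcons.
  by rewrite -big_distrr/= p_sum mulr1.
rewrite -sumEFin big_seq_cond.
apply: (@le_trans _ _ (\sum_(u <- U (size w)) load (rcons w u))%E).
  rewrite [leRHS]big_seq_cond; apply: lee_sum => u; rewrite andbT; exact: H.
rewrite -nneseries_sum; last first.
  by move=> u n _; rewrite lee_fin; case: ifP => // _; exact: mass_ge0.
rewrite /load; apply: lee_nneseries => [i _ _|i _].
  by apply: sume_ge0 => u _; rewrite lee_fin; case: ifP => // _; exact: mass_ge0.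
rewrite sumEFin lee_fin.
rewrite (eq_bigr (fun u => (prefix (rcons w u) (ws i))%:R * mass (ws i))); last first.
  by move=> u _; case: ifP; rewrite ?mul1r ?mul0r.
rewrite -big_distrl/= -natr_sum.
rewrite [leRHS](_ : _ = (prefix w (ws i))%:R * mass (ws i)); last by case: ifP; rewrite ?mul1r ?mul0r.
rewrite ler_wpM2r ?mass_ge0// ler_nat.
exact: prefix_rcons_uniq.
Qed.

Lemma avoid_nodes : (\sum_(0 <= i <oo) (mass (ws i))%:E < 1)%E ->
  exists om : nat -> T, (forall n, om n \in U n) /\
    forall i, ws i != mkseq om (size (ws i)).
Proof.
move=> lt1.
pose ok w := (load w < (mass w)%:E)%E.
have ok0 : ok [::].
  rewrite /ok /load /mass big_ord0; under eq_eseriesr do rewrite prefix0s.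
  exact: lt1.
have step w : exists u, ok w -> u \in U (size w) /\ ok (rcons w u).
  have [okw|nok] := pselect (ok w); last by exists t0.
  by have [u uU oku] := load_child okw; exists u.
have [nx nxP] := choice step.
pose node := fix node n := if n is n'.+1 then rcons (node n') (nx (node n')) else [::].
have size_node n : size (node n) = n by elim: n => //= n IH; rewrite size_rcons IH.
have ok_node n : ok (node n).
  by elim: n => //= n IH; have [] := nxP _ IH.
pose om n := nx (node n).
have nodeE n : node n = mkseq om n.
  by elim: n => // n IH; rewrite /= mkseqS -IH.
exists om; split=> [n|i].
  by have [+ _] := nxP _ (ok_node n); rewrite size_node.
(* On a branch through [ws i] the load at that node would contain the term of [ws i] itself, already
   equal to the mass of the node. *)
apply/eqP => e; have := ok_node (size (ws i)).
rewrite nodeE -e /ok; apply/negP; rewrite -leNgt /load.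
have h0 j : (0 <= (if prefix (ws i) (ws j) then mass (ws j) else 0)%:E)%E.
  by rewrite lee_fin; case: ifP => // _; exact: mass_ge0.
rewrite (@nneseriesD1 _ (fun j => (if prefix (ws i) (ws j) then mass (ws j) else 0)%:E) i)//.
rewrite prefix_refl leeDl//; apply: nneseries_ge0 => *; exact: h0.
Qed.

End Tree.

(** * Hausdorff measure and dimension of subsets of [0, 1] *)

Section Hausdorff.
Variable R : realType.
Implicit Types (E U : set R) (s : R).

Lemma diam_ge0 U : (0 <= diam U)%E.
Proof. by apply: ereal_sup_ubound; left. Qed.

Lemma diam_le U (d : R) : 0 <= d -> (forall y z, U y -> U z -> `|y - z| <= d) ->
  (diam U <= d%:E)%E.
Proof.
move=> d0 h; apply: ge_ereal_sup => _ [->|[y Uy [z Uz <-]]]; rewrite lee_fin//.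
exact: h.
Qed.

Lemma le_fine_diam U y z : (diam U <= 1%:E)%E -> U y -> U z -> `|y - z| <= fine (diam U).
Proof.
move=> U1 Uy Uz.
have : diam U \is a fin_num.
  by rewrite ge0_fin_numE ?diam_ge0// (le_lt_trans U1)// ltry.
move=> /fineK e; rewrite -lee_fin e; apply: ereal_sup_ubound; right.
by exists y => //; exists z.
Qed.

Lemma content_ge0 s d E : (0 <= hausdorff_content s d E)%E.
Proof.
apply: le_ereal_inf_tmp => _ [U _ <-]; apply: nneseries_ge0 => i _ _.
by rewrite lee_fin powR_ge0.
Qed.

(** Covering [0, 1] by n intervals of length 1/n costs n^(1 - s), which tends to 0. *)
Lemma measure_gt1 s E : E `<=` `[0, 1] -> 1 < s -> hausdorff_measure s E = 0%E.
Proof.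
move=> E01 s1; apply/eqP; rewrite eq_le; apply/andP; split; last first.
  by apply: (le_trans (content_ge0 s 1 E)); apply: ereal_sup_ubound; exists 1 => //=.
apply: ge_ereal_sup => _ [d d0 <-].
apply/lee_addgt0Pr => e e0; rewrite add0e.
(* With 1/n <= a, the first bound controls the mesh and the second gives n^(1 - s) <= e. *)
pose a := Num.min d (e `^ (s - 1)^-1).
have ep : 0 < e `^ (s - 1)^-1 by rewrite powR_gt0.
have a0 : 0 < a by rewrite lt_min d0.
pose n := (Num.truncn a^-1).+1.
have n0 : 0 < n%:R :> R by rewrite ltr0n.
have na : n%:R^-1 <= a by rewrite invf_ple ?posrE//; apply: ltW; exact: truncnS_gt.
pose U i : set R := if (i < n)%N then [set` `[i%:R / n%:R, i.+1%:R / n%:R]] else set0.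
have dU i : (diam (U i) <= (if (i < n)%N then n%:R^-1 else 0)%:E)%E.
  apply: diam_le; first by case: ifP => //; rewrite invr_ge0.
  rewrite /U; case: ifP => // _ y z /=; rewrite !in_itv/=.
  have -> : i.+1%:R / n%:R = i%:R / n%:R + n%:R^-1 :> R by rewrite -natr1 mulrDl mul1r.
  by move=> /andP[y0 y1] /andP[z0 z1]; rewrite ler_norml; apply/andP; split; lra.
have fU i : fine (diam (U i)) <= if (i < n)%N then n%:R^-1 else 0.
  by rewrite -lee_fin fineK// ge0_fin_numE ?diam_ge0// (le_lt_trans (dU i))// ltry.
apply: ge_ereal_inf.
exists (\sum_(0 <= i <oo) (fine (diam (U i)) `^ s)%:E)%E; first exists U => //.
  split=> [y /E01|i]; last first.
    apply: (le_trans (dU i)); rewrite lee_fin; case: ifP => _; last exact: ltW.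
    by apply: (le_trans na); rewrite ge_min lexx.
  rewrite /= in_itv/= => /andP[y0 y1].
  have [yn|yn] := ltP (y * n%:R) n%:R.
    have yn0 : 0 <= y * n%:R by rewrite mulr_ge0// ltW.
    exists (Num.truncn (y * n%:R)) => //.
    have /andP[t1 t2] := truncn_itv yn0.
    rewrite /U ifT; last by rewrite -(@ltr_nat R); exact: le_lt_trans t1 yn.
    by rewrite /= in_itv/= ler_pdivrMr// t1 ler_pdivlMr// ltW.
  exists n.-1 => //; rewrite /U ifT ?ltn_predL//.
  rewrite /= in_itv/= divff ?gt_eqF// y1 andbT.
  have {}y1 : 1 <= y by rewrite -(ler_pM2r n0) mul1r.
  by apply: le_trans y1; rewrite ler_pdivrMr// mul1r ler_nat.
have h0 k : (0 <= (fine (diam (U k)) `^ s)%:E)%E by rewrite lee_fin powR_ge0.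
rewrite (@nneseries_split _ _ 0 n)// add0n.
(* The empty sets that complete the cover have diameter 0, thanks to the 0 adjoined in [diam], and
   contribute 0 since s > 0. *)
rewrite [X in (_ + X)%E]eseries0; last first.
  move=> i ni _; congr _%:E; have := fU i; rewrite ltnNge ni/= => hi.
  rewrite (_ : fine _ = 0) ?powR0 ?gt_eqF//; first by lra.
  by apply/eqP; rewrite eq_le hi fine_ge0// diam_ge0.
rewrite adde0 sumEFin lee_fin big_mkord.
apply: (@le_trans _ _ (\sum_(i < n) n%:R^-1 `^ s)).
  apply: ler_sum => i _; have := fU i; rewrite ltn_ord => hi.
  apply: ge0_ler_powR; rewrite ?nnegrE ?invr_ge0 ?fine_ge0 ?diam_ge0//.
  exact: le_trans ler01 (ltW s1).
rewrite sumr_const card_ord -[X in X <= _]mulr_natl.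
have -> : s = 1 + (s - 1) by lra.
rewrite powRD; last by rewrite invr_eq0 (gt_eqF n0) implybT.
rewrite powRr1 ?invr_ge0// mulrA divff ?gt_eqF// mul1r.
apply: (@le_trans _ _ ((e `^ (s - 1)^-1) `^ (s - 1))).
  apply: ge0_ler_powR; rewrite ?nnegrE ?invr_ge0 ?(ltW ep)//; first by lra.
  by apply: le_trans na _; rewrite ge_min lexx orbT.
by rewrite -powRrM mulVf ?powRr1 ?(ltW e0)// gt_eqF// subr_gt0.
Qed.

Lemma dim_eq1 E : E `<=` `[0, 1] ->
  (forall s, 0 < s -> s < 1 -> hausdorff_measure s E <> 0%E) -> hausdorff_dim E = 1%:E.
Proof.
move=> E01 H; apply/eqP; rewrite eq_le; apply/andP; split.
  apply/lee_addgt0Pr => e e0; apply: ereal_inf_lbound; exists (1 + e) => //=.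
  by split; [lra|apply: measure_gt1 => //; lra].
apply: le_ereal_inf_tmp => _ [s [s0 /= Hs] <-]; rewrite lee_fin leNgt; apply/negP => s1.
exact: (H s).
Qed.

(** Mesh 1 is fine enough: the mass argument only asks for finite diameters. *)
Lemma measure0_cover s E (e : R) : hausdorff_measure s E = 0%E -> 0 < e ->
  exists U : nat -> set R, [/\ E `<=` \bigcup_i U i, forall i, (diam (U i) <= 1%:E)%E &
    (\sum_(0 <= i <oo) (fine (diam (U i)) `^ s)%:E < e%:E)%E].
Proof.
move=> m0 e0.
have : (hausdorff_content s 1 E < e%:E)%E.
  apply: (@le_lt_trans _ _ 0%E); last by rewrite lte_fin.
  by rewrite -m0; apply: ereal_sup_ubound; exists 1 => //=.
by move=> /ereal_inf_lt[_ [U [EU dU] <-] lt]; exists U; split.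
Qed.

End Hausdorff.

(** * Nonzero Hausdorff measure from a tree with a mass and gap estimate *)

Section TreeMeasure.
Variables (R : realType) (T : eqType) (t0 : T) (U : nat -> seq T) (p : nat -> T -> R).
Hypothesis U_uniq : forall n, uniq (U n).
Hypothesis p_ge0 : forall n u, 0 <= p n u.
Hypothesis p_sum : forall n, \sum_(u <- U n) p n u = 1.
Let branch (om : nat -> T) := forall n, om n \in U n.
Let mass := mass t0 p.
Variables (X : (nat -> T) -> R) (E : set R) (s C0 : R).
Hypothesis s0 : 0 < s.
Hypothesis C00 : 0 < C0.
Hypothesis X_E : forall om, branch om -> E (X om).
Hypothesis mass_gap : forall om om' n, branch om -> branch om' ->
  mkseq om n = mkseq om' n -> om n <> om' n ->
  mass (mkseq om n) <= C0 * `|X om - X om'| `^ s.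
Hypothesis mass_cvg0 : forall om (e : R), branch om -> 0 < e ->
  exists n, mass (mkseq om n) <= e.

Lemma exists_branch : exists om, branch om.
Proof.
suff /choice[om h] : forall n, exists u, u \in U n by exists om.
move=> n; case e : (U n) => [|u l].
  by have := p_sum n; rewrite e big_nil => /eqP; rewrite eq_sym oner_eq0.
by exists u; rewrite inE eqxx.
Qed.

(* [w] is the longest common prefix of the branches landing in [V], or a very long
   prefix when there is at most one such branch. *)
Lemma cover_node (V : set R) (e : R) : (diam V <= 1%:E)%E -> 0 < e ->
  exists w, mass w <= C0 * fine (diam V) `^ s + e /\
    forall om, branch om -> V (X om) -> w = mkseq om (size w).
Proof.
move=> dV e0.
have gee (c : R) : c <= e -> c <= C0 * fine (diam V) `^ s + e.
  move=> ce; apply: le_trans ce _; rewrite lerDr mulr_ge0 ?powR_ge0//; exact: ltW.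
have [[om0 [b0 V0]]|none] := pselect (exists om, branch om /\ V (X om)); last first.
  have [om b] := exists_branch; have [n hn] := mass_cvg0 b e0.
  exists (mkseq om n); split; first exact: gee.
  by move=> om' b' V'; exfalso; apply: none; exists om'.
pose agree n := `[< forall om, branch om -> V (X om) -> mkseq om n = mkseq om0 n >].
have [all|] := pselect (forall n, agree n).
  have [n hn] := mass_cvg0 b0 e0.
  exists (mkseq om0 n); split; first exact: gee.
  by move=> om b Vx; rewrite size_mkseq; have /asboolP h := all n; rewrite h.
move=> /existsNP[n0 /negP nn0].
have ex : exists n, ~~ agree n by exists n0.
case: (ex_minnP ex) => -[|m].
  by move=> /negP H; exfalso; apply: H; apply/asboolP.
move=> /asboolPn /existsNP[om /not_implyP[b /not_implyP[Vx ne]]] min.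
have agm : agree m by apply: contraT => /min; rewrite ltnn.
exists (mkseq om0 m); split; last first.
  by move=> om' b' V'; rewrite size_mkseq; move/asboolP: agm => ->.
have em : mkseq om0 m = mkseq om m by move/asboolP: agm => ->.
apply: (@le_trans _ _ (C0 * `|X om0 - X om| `^ s)).
  apply: mass_gap => // eom; apply: ne; by rewrite !mkseqS em eom.
apply: ler_wpDr; first exact: ltW.
rewrite ler_wpM2l ?(ltW C00)// ge0_ler_powR ?nnegrE//; first exact: ltW.
  by rewrite fine_ge0// diam_ge0.
exact: le_fine_diam.
Qed.

(** A cover with s-sum below 1/(2 C0) yields nodes of total mass below 1/2 plus the errors, which
    are chosen to sum to 1/2. The branch avoiding all these nodes gives a point of [E] outside the
    cover. *)
Lemma tree_measure_neq0 : hausdorff_measure s E <> 0%E.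
Proof.
move=> m0.
have e1 : 0 < (2 * C0)^-1 by rewrite invr_gt0 mulr_gt0.
have [V [EV dV sV]] := measure0_cover m0 e1.
have step i : exists w, mass w <= C0 * fine (diam (V i)) `^ s + 2^-1 / (2 ^ i.+1)%:R /\
    forall om, branch om -> V i (X om) -> w = mkseq om (size w).
  by apply: cover_node => //; rewrite divr_gt0// ltr0n expn_gt0.
have [ws hws] := choice step.
have [|om [b hom]] := avoid_nodes U_uniq p_ge0 p_sum (t0 := t0) (ws := ws).
  apply: (@le_lt_trans _ _ (\sum_(0 <= i <oo)
     ((C0 * fine (diam (V i)) `^ s)%:E + (2^-1 / (2 ^ i.+1)%:R)%:E))%E).
    apply: lee_nneseries => i _; first by rewrite lee_fin mass_ge0.
    by rewrite -EFinD lee_fin; have [] := hws i.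
  have h0 i : (0 <= (fine (diam (V i)) `^ s)%:E)%E by rewrite lee_fin powR_ge0.
  apply: le_lt_trans (epsilon_trick _ _ _) _ => //.
    by move=> i; rewrite EFinM mule_ge0// lee_fin ltW.
  under eq_eseriesr do rewrite EFinM.
  rewrite nneseriesZl//.
  have : (C0%:E * \sum_(0 <= i <oo) (fine (diam (V i)) `^ s)%:E < C0%:E * ((2 * C0)^-1)%:E)%E.
    by rewrite lte_pmul2l.
  rewrite -EFinM (_ : C0 * (2 * C0)^-1 = 2^-1); last by field; rewrite gt_eqF.
  move=> lt; rewrite [ltRHS](_ : _ = 2^-1%:E + 2^-1%:E)%E; last by rewrite -EFinD -mulr2n -[_ *+ 2]mulr_natr mulVf.
  by rewrite lteD2rE.
have [i _ Vi] := EV _ (X_E b).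
by have [_ /(_ om b Vi) e] := hws i; have := hom i; rewrite -e eqxx.
Qed.

End TreeMeasure.

(** * Steering averages along a connected set *)

Section Tracking.
Variables (R : realType) (V : normedModType R).
Implicit Types (x y : V) (C : set V).

Definition eclose (e : R) : rel V := [rel x y | `|x - y| < e].

(** The points reachable from [x] by such chains inside [C] form a nonempty subset that is
    relatively open and relatively closed. *)
Lemma chain_connected C (e : R) x y : connected C -> 0 < e -> C x -> C y ->
  exists s : seq V, [/\ {in s, forall z, C z}, path (eclose e) x s & last x s = y].
Proof.
move=> Cconn e0 Cx Cy.
pose B := [set z | C z /\
  exists s : seq V, [/\ {in s, forall z, C z}, path (eclose e) x s & last x s = z]].
have BC : B `<=` C by move=> z [].
have ext z z' : B z -> C z' -> `|z - z'| < e -> B z'.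
  move=> [Cz [s [sC sp sl]]] Cz' zz'; split=> //.
  exists (rcons s z'); split.
  - by move=> u; rewrite mem_rcons inE => /predU1P[->|/sC].
  - by rewrite rcons_path sp sl.
  - by rewrite last_rcons.
suff BE : B = C by have [] : B y by rewrite BE.
apply: Cconn.
- by exists x; split=> //; exists [::]; split.
- exists (\bigcup_(b in B) ball b e).
    by apply: bigcup_open => b _; exact: ball_open.
  apply/seteqP; split=> [z Bz|z [Cz [b Bb]]].
    by split; [exact: BC|exists z => //; exact: ballxx].
  by rewrite -ball_normE /ball_ /= => bz; exact: ext Bb Cz bz.
- exists (~` \bigcup_(c in C `\` B) ball c e).
    by apply: open_closedC; apply: bigcup_open => b _; exact: ball_open.
  apply/seteqP; split=> [z Bz|z [Cz nz]].
    split; first exact: BC.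
    move=> [c [Cc nBc]]; rewrite -ball_normE /ball_ /= => cz.
    by apply: nBc; apply: ext Bz Cc _; rewrite distrC.
  apply: contrapT => nBz; apply: nz; exists z => //; exact: ballxx.
Qed.

Section Concat.
Variables (d : nat -> V) (L : nat -> seq V).
Hypothesis L_path : forall k, path (eclose k.+1%:R^-1) (d k) (L k).
Hypothesis L_last : forall k, last (d k) (L k) = d k.+1.
Hypothesis L_ne : forall k, L k != [::].

Let F n := flatten (mkseq L n).
Let q i := nth 0 (F i.+1) i.

Let FS n : F n.+1 = F n ++ L n.
Proof. by rewrite /F mkseqS -cats1 flatten_cat /= cats0. Qed.

Let F_size n : (n <= size (F n))%N.
Proof.
elim: n => // n IH; rewrite FS size_cat -addn1 leq_add//.
by case: (L n) (L_ne n).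
Qed.

Let F_prefix n m : (n <= m)%N -> exists v, F m = F n ++ v.
Proof.
move=> /subnK <-; elim: (m - n)%N => [|k [v e]]; first by exists [::]; rewrite cats0.
by exists (v ++ L (k + n)); rewrite addSn FS e catA.
Qed.

Let qE n i : (i < size (F n))%N -> q i = nth 0 (F n) i.
Proof.
move=> hn; rewrite /q; have hk := F_size i.+1.
have [le|lt] := leqP n i.+1.
  by have [v ->] := F_prefix le; rewrite [LHS]nth_cat hn.
by have [v ->] := F_prefix (ltnW lt); rewrite [RHS]nth_cat hk.
Qed.

(** Chains of index [k] and later have mesh at most 1/(k+1), so what remains after the first [k] of
    them is still a path for that mesh, started at [d k]. *)
Let F_drop k n : path (eclose k.+1%:R^-1) (d k) (drop (size (F k)) (F (n + k))) /\
  last (d k) (drop (size (F k)) (F (n + k))) = d (n + k).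
Proof.
elim: n => [|n [IHp IHl]]; first by rewrite drop_size.
have le : (size (F k) <= size (F (n + k)))%N.
  by have [v ->] := F_prefix (leq_addl n k); rewrite size_cat leq_addr.
rewrite addSn FS drop_cat; have := le; rewrite leq_eqVlt => /predU1P[e|lt]; last first.
  rewrite lt cat_path last_cat IHp IHl L_last; split=> //=.
  apply: sub_path (L_path _) => a b /=; rewrite /eclose /= => /lt_le_trans; apply.
  by rewrite lef_pV2 ?posrE// ler_nat ltnS leq_addl.
rewrite e ltnn subnn drop0.
move: IHl; rewrite e drop_size /= => ->; rewrite L_last; split=> //.
apply: sub_path (L_path _) => a b /=; rewrite /eclose /= => /lt_le_trans; apply.
by rewrite lef_pV2 ?posrE// ler_nat ltnS leq_addl.
Qed.

Lemma concat_chains (C : set V) : (forall k, {in L k, forall z, C z}) ->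
  exists q : nat -> V, [/\ forall i, C (q i),
    forall e : R, 0 < e -> exists i0, forall i, (i0 <= i)%N -> `|q i.+1 - q i| < e &
    forall k, exists2 i, (k <= i)%N & q i = d k.+1].
Proof.
move=> LC; exists q; split.
- move=> i; have : q i \in F i.+1 by apply: mem_nth; exact: F_size.
  by move=> /flattenP[s /mapP[k _ ->]]; exact: LC.
- move=> e e0; pose k := Num.truncn e^-1; exists (size (F k)) => i ki.
  pose n := i.+2; have [hp _] := F_drop k n.
  have szn : (i.+1 < size (F (n + k)))%N by apply: leq_trans (F_size _); rewrite leq_addr.
  rewrite (qE szn) (@qE (n + k) i) ?(ltnW szn)//.
  set s := drop _ _ in hp.
  have szs : ((i - size (F k)).+1 < size s)%N.
    by rewrite /s size_drop -subSn// ltn_sub2r//; apply: leq_ltn_trans szn; exact: leqW.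
  have := pathP 0 hp _ szs; rewrite /= /s !nth_drop addnS subnKC// /eclose /= distrC => /lt_le_trans; apply.
  rewrite invf_ple ?posrE//; apply: ltW; exact: truncnS_gt.
- move=> k; exists (size (F k.+1)).-1.
    by rewrite -ltnS prednK ?F_size//; apply: leq_ltn_trans (F_size _).
  have sz : (0 < size (F k.+1))%N by apply: leq_ltn_trans (F_size _).
  rewrite (@qE k.+1) ?ltn_predL// nth_last FS last_cat.
  by rewrite -L_last; case: (L k) (L_ne k).
Qed.

End Concat.

Section Greedy.
Variables (q : nat -> V) (w : nat -> R).
Hypothesis w_gt0 : forall n, 0 < w n.
Let W n := \sum_(i < n) w i.
Hypothesis W_unbounded : forall M, exists n, M <= W n.

Let WS n : W n.+1 = W n + w n. Proof. by rewrite /W big_ord_recr. Qed.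

Let W_ge0 n : 0 <= W n. Proof. by apply: sumr_ge0 => i _; exact: ltW. Qed.

Let W_gt0 n : 0 < W n.+1. Proof. by rewrite WS ltr_wpDl. Qed.

(* Aim at [q k] until the weighted average is within 1/(k+1) of it, then move on
   to [q k.+1]. *)
Let st := fix st n : nat * V := if n is n'.+1 then
   let: (k, Sm) := st n' in
   let Sm' := Sm + w n' *: q k in
   ((if `|(W n'.+1)^-1 *: Sm' - q k| <= k.+1%:R^-1 then k.+1 else k), Sm')
 else (0%N, 0).

Let kap n := (st n).1.
Let Sm n := (st n).2.

Let SmS n : Sm n.+1 = Sm n + w n *: q (kap n).
Proof. by rewrite /Sm /kap /=; case: (st n). Qed.

Let kapS n : kap n.+1 =
  if `|(W n.+1)^-1 *: Sm n.+1 - q (kap n)| <= (kap n).+1%:R^-1 then (kap n).+1 else kap n.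
Proof. by rewrite SmS /Sm /kap /=; case: (st n). Qed.

Let SE n : Sm n = \sum_(i < n) w i *: q (kap i).
Proof.
elim: n => [|n IH]; first by rewrite big_ord0.
by rewrite SmS IH big_ord_recr.
Qed.

(** The deviation before division by the total weight: weight added on [q k] leaves it unchanged, so
    the normalised deviation decays as long as the aim stays the same. *)
Let dev n k : R := `|Sm n - W n *: q k|.

Let devE n k : `|(W n.+1)^-1 *: Sm n.+1 - q k| = dev n.+1 k / W n.+1.
Proof.
have W0 := W_gt0 n.
rewrite /dev mulrC -[X in X * _](ger0_norm (_ : 0 <= _)) ?invr_ge0 ?W_ge0//.
by rewrite -normrZ scalerBr scalerA mulVf ?scale1r// gt_eqF.
Qed.

Let dev_stay n : dev n.+1 (kap n) = dev n (kap n).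
Proof. by rewrite /dev SmS WS scalerDl opprD addrACA subrr addr0. Qed.

(** When the aim moves to [q k], the average is within 1/k of the previous aim [q k.-1]; the second
    term is the jump between the two aims. *)
Let E k : R := k%:R^-1 + `|q k - q k.-1|.

(** The first average is exactly [q 0], so the aim moves at once and [k.-1] in [E] is afterwards a
    genuine predecessor. *)
Let kap_ge1 n : (0 < kap n.+1)%N.
Proof.
elim: n => [|n IH]; rewrite kapS.
  rewrite devE dev_stay /dev /Sm /W big_ord0 /= scale0r subr0 normr0 mul0r.
  by rewrite invr_ge0 ler0n.
by case: ifP.
Qed.

Let dev_le n : dev n.+1 (kap n.+1) <= W n.+1 * E (kap n.+1).
Proof.
have succ m : `|(W m.+1)^-1 *: Sm m.+1 - q (kap m)| <= (kap m).+1%:R^-1 ->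
    dev m.+1 (kap m).+1 <= W m.+1 * E (kap m).+1.
  move=> h; rewrite mulrC -ler_pdivrMr ?W_gt0// -devE /E /=.
  rewrite -(subrK (q (kap m)) (_ *: _)) -addrA.
  by apply: le_trans (ler_normD _ _) _; rewrite lerD// distrC.
elim: n => [|n IH].
  have := kap_ge1 0; rewrite kapS; case: ifP => [h _|_]; first exact: succ.
  by rewrite /kap.
rewrite kapS; case: ifP => h; first exact: succ.
rewrite dev_stay; apply: le_trans IH _; rewrite ler_wpM2r ?WS ?lerDl ?(ltW (w_gt0 _))//.
by rewrite addr_ge0 ?invr_ge0 ?ler0n.
Qed.

Let kap_leS n : (kap n <= kap n.+1 <= (kap n).+1)%N.
Proof. by rewrite kapS; case: ifP; rewrite !leqnn !leqnSn. Qed.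

Let kap_homo n m : (n <= m)%N -> (kap n <= kap m)%N.
Proof.
move=> /subnK <-; elim: (m - n)%N => // k IH; apply: leq_trans IH _.
by rewrite addSn; have /andP[] := kap_leS (k + n).
Qed.

(** If the aim stayed forever, the deviation would be constant while the total weight is unbounded,
    and the test would eventually succeed. *)
Let kap_progress n : exists2 m, (n <= m)%N & kap m = (kap n).+1.
Proof.
apply: contrapT => H.
have stay m : (n <= m)%N -> kap m = kap n.
  move=> /subnK <-; elim: (m - n)%N => // k IH; rewrite addSn.
  have /andP[h1 h2] := kap_leS (k + n); rewrite IH in h1 h2.
  apply/eqP; rewrite eqn_leq h1 andbT leqNgt; apply/negP => h3; apply: H.
  exists (k + n).+1; first by rewrite leqW// leq_addl.
  by apply/eqP; rewrite eqn_leq h2.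
have devc m : (n <= m)%N -> dev m (kap n) = dev n (kap n).
  move=> nm; have := nm => /subnK <-; elim: (m - n)%N => // k IH.
  by rewrite addSn -{1}(stay (k + n)) ?leq_addl// dev_stay stay ?leq_addl.
have [m hm] := W_unbounded (dev n (kap n) * (kap n).+1%:R).
pose M := maxn n m.
have nM : (n <= M)%N by exact: leq_maxl.
have := kapS M; rewrite !stay ?leqW//; case: ifP => [_ /n_Sn//|/negP h _]; apply: h.
rewrite devE devc ?leqW// ler_pdivrMr ?W_gt0// mulrC ler_pdivlMr ?ltr0n//.
apply: le_trans hm _; rewrite /W -!(big_mkord xpredT).
rewrite [leRHS](big_cat_nat (n := m)) ?leqW ?leq_maxr//= lerDl.
by apply: sumr_ge0 => i _; exact: ltW.
Qed.

Lemma greedy_tracking : exists kap : nat -> nat,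
  [/\ forall k, exists2 n, (k <= n)%N & kap n = k,
      forall K, exists n0, forall n, (n0 <= n)%N -> (K <= kap n)%N &
      forall n, (0 < kap n.+1)%N /\
       `|(W n.+1)^-1 *: (\sum_(i < n.+1) w i *: q (kap i)) - q (kap n.+1)| <=
         (kap n.+1)%:R^-1 + `|q (kap n.+1) - q (kap n.+1).-1| ].
Proof.
have onto k : exists2 n, (k <= n)%N & kap n = k.
  elim: k => [|k [n kn e]]; first by exists 0%N.
  have [m nm em] := kap_progress n; exists m; last by rewrite em e.
  apply: (leq_ltn_trans kn); rewrite ltn_neqAle nm andbT.
  by apply/eqP => h; move: em; rewrite -h => /eqP; rewrite -(inj_eq succn_inj) eqn_leq ltnn andbF.
exists kap; split=> //.
  move=> K; have [n _ e] := onto K; exists n => m /kap_homo; by rewrite e.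
move=> n; split; first exact: kap_ge1.
by rewrite -SE devE ler_pdivrMr ?W_gt0// mulrC; exact: dev_le.
Qed.

End Greedy.
End Tracking.

(** * Target sequences whose weighted averages accumulate exactly on C *)

Section Targets.
Variable R : realType.
Local Notation V := (R * R * R)%type.
Implicit Types (C : set V) (c : V).

(** One point of [C] is picked near each rational grid point that is close to [C]. Each must recur
    infinitely often, since every point of [C] has to be approached at arbitrarily late times. *)
Lemma dense_sequence C : C `<=` @simplex R -> C !=set0 ->
  exists d : nat -> V, (forall k, C (d k)) /\
    forall c, C c -> forall e : R, 0 < e -> forall k0, exists2 k, (k0 <= k)%N & `|d k - c| <= e.
Proof.
move=> Csub [c0 Cc0].
pose cell (t : nat * (nat * nat * nat)) : V :=
  (t.2.1.1%:R / t.1.+1%:R, t.2.1.2%:R / t.1.+1%:R, t.2.2%:R / t.1.+1%:R).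
have pick_cell (t : nat * (nat * nat * nat)) : exists c, C c /\
    ((exists2 c, C c & `|c - cell t| <= t.1.+1%:R^-1) -> `|c - cell t| <= t.1.+1%:R^-1).
  by have [[c Cc hc]|] := pselect (exists2 c, C c & `|c - cell t| <= t.1.+1%:R^-1);
    [exists c|exists c0].
have [pk hpk] := choice pick_cell.
pose d' k := if unpickle k is Some t then pk t else c0.
(* k |-> logn 2 k.+1 takes every value infinitely often. *)
exists (fun k => d' (logn 2 k.+1)); split.
  by move=> k; rewrite /d'; case: unpickle => // t; have [] := hpk t.
move=> c Cc e e0 k0.
pose m := Num.truncn (2 / e).
have m0 : 0 < m.+1%:R :> R by rewrite ltr0n.
have me : 2 * m.+1%:R^-1 <= e.
  by rewrite ler_pdivrMr// mulrC -ler_pdivrMr// ltW// truncnS_gt.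
have coord (y : R) : 0 <= y -> exists a : nat, `|y - a%:R / m.+1%:R| <= m.+1%:R^-1.
  move=> y0; exists (Num.truncn (y * m.+1%:R)).
  have /andP[t1 t2] := truncn_itv (mulr_ge0 y0 (ltW m0)).
  have -> : y - (Num.truncn (y * m.+1%:R))%:R / m.+1%:R =
    (y * m.+1%:R - (Num.truncn (y * m.+1%:R))%:R) / m.+1%:R by rewrite mulrBl mulfK ?gt_eqF.
  rewrite ger0_norm ?divr_ge0 ?subr_ge0// ?(ltW m0)// ler_pdivrMr// mulVf ?gt_eqF//.
  by rewrite lerBlDl natr1 ltW.
have [p1 p2 p3 _] := Csub _ Cc.
have [a1 h1] := coord _ p1; have [a2 h2] := coord _ p2; have [a3 h3] := coord _ p3.
pose t := (m, (a1, a2, a3)).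
have hc : `|c - cell t| <= m.+1%:R^-1 by apply: prod3_norm_le.
(* The successor of this index has 2-adic valuation [pickle t], and the odd factor makes the index
   at least [k0]. *)
exists (2 ^ pickle t * k0.*2.+1).-1.
  rewrite -ltnS prednK ?muln_gt0 ?expn_gt0//.
  by apply: (@leq_trans k0.*2.+1); [rewrite ltnS -addnn leq_addr|rewrite leq_pmull// expn_gt0].
rewrite prednK ?muln_gt0 ?expn_gt0// lognM ?expn_gt0// pfactorK// (@lognE 2 k0.*2.+1).
rewrite dvdn2 /= odd_double /= addn0 /d' pickleK.
have [_ h] := hpk t; have := h (ex_intro2 _ _ c Cc hc) => /= hd.
rewrite -(subrK (cell t) (pk t)) -addrA.
apply: le_trans (ler_normD _ _) _; rewrite (distrC _ c).
by apply: le_trans me; rewrite mulr_natl mulr2n lerD.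
Qed.

Lemma slow_chain C : C `<=` @simplex R -> C !=set0 -> connected C ->
  exists q : nat -> V, [/\ forall i, C (q i),
    forall e : R, 0 < e -> exists i0, forall i, (i0 <= i)%N -> `|q i.+1 - q i| < e &
    forall c, C c -> forall e : R, 0 < e -> forall k0, exists2 k, (k0 <= k)%N & `|q k - c| <= e].
Proof.
move=> Csub Cne Cconn; have [d [dC d_dense]] := dense_sequence Csub Cne.
have step k : exists s : seq V, [/\ {in s, forall z, C z}, path (eclose k.+1%:R^-1) (d k) s,
    last (d k) s = d k.+1 & s != [::]].
  have e0 : 0 < k.+1%:R^-1 :> R by rewrite invr_gt0 ltr0n.
  have [s [sC sp sl]] := chain_connected Cconn e0 (dC k) (dC k.+1).
  (* Repeating the endpoint makes every chain nonempty, as the concatenation requires. *)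
  exists (rcons s (d k.+1)); split.
  - by move=> u; rewrite mem_rcons inE => /predU1P[->//|/sC].
  - by rewrite rcons_path sp sl /eclose /= subrr normr0.
  - by rewrite last_rcons.
  - by case: (s).
have [L hL] := choice step.
have [||||q [qC q_slow q_visit]] := @concat_chains R V d L _ _ _ C.
- by move=> k; have [] := hL k.
- by move=> k; have [] := hL k.
- by move=> k; have [] := hL k.
- by move=> k; have [] := hL k.
exists q; split=> // c Cc e e0 k0.
have [k kk hk] := d_dense c Cc e e0 k0.+1.
have [i ki hi] := q_visit k.-1.
exists i; first by apply: leq_trans ki; rewrite -ltnS prednK//; exact: leq_trans kk.
by rewrite hi prednK//; exact: leq_trans kk.
Qed.

Definition wt (i : nat) : R := i.+1%:R ^+ 3.
Definition Wt n : R := \sum_(i < n) wt i.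

Lemma wt_gt0 i : 0 < wt i. Proof. by rewrite exprn_gt0// ltr0n. Qed.

Lemma Wt_ge n : n%:R ^+ 4 / 4 <= Wt n.
Proof.
elim: n => [|n IH]; first by rewrite /Wt big_ord0 expr0n mul0r.
rewrite /Wt big_ord_recr/= -/(Wt n).
apply: (@le_trans _ _ (n%:R ^+ 4 / 4 + wt n)); last by rewrite lerD2r.
rewrite /wt -natr1; have := ler0n R n; move: (n%:R : R) => x x0.
have x2 : 0 <= x ^+ 2 by rewrite exprn_ge0.
have x3 : 0 <= x ^+ 3 by rewrite exprn_ge0.
have -> : (x + 1) ^+ 4 = x ^+ 4 + 4 * x ^+ 3 + 6 * x ^+ 2 + 4 * x + 1 by ring.
have -> : (x + 1) ^+ 3 = x ^+ 3 + 3 * x ^+ 2 + 3 * x + 1 by ring.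
by lra.
Qed.

Lemma Wt_unbounded M : exists n, M <= Wt n.
Proof.
pose n := (Num.truncn (4 * `|M|)).+1.
exists n; apply: le_trans (Wt_ge n).
have n1 : 1 <= n%:R :> R by rewrite ler1n.
have : 4 * `|M| < n%:R by exact: truncnS_gt.
have := ler_norm M.
have : n%:R <= n%:R ^+ 4 :> R by rewrite -[leLHS]expr1 ler_weXn2l.
by lra.
Qed.

(** The average at time [n] shadows [q (kap n)] because the steps of [q] tend to 0; since [kap]
    takes every value, the recurrence of [q] near each point of [C] passes to the averages. *)
Lemma averages_target C : C `<=` @simplex R -> C !=set0 -> connected C ->
  exists p : nat -> V, [/\ forall i, C (p i),
    forall e : R, 0 < e -> exists n0, forall n, (n0 <= n)%N ->
      exists2 c, C c & `|(Wt n)^-1 *: (\sum_(i < n) wt i *: p i) - c| <= e &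
    forall c, C c -> forall e : R, 0 < e -> forall n0, exists2 n, (n0 <= n)%N &
      `|(Wt n)^-1 *: (\sum_(i < n) wt i *: p i) - c| <= e].
Proof.
move=> Csub Cne Cconn; have [q [qC q_slow q_dense]] := slow_chain Csub Cne Cconn.
have [kap [onto grow near]] := greedy_tracking q wt_gt0 Wt_unbounded.
have err (e : R) : 0 < e -> exists K, forall n, (0 < n)%N -> (K <= kap n)%N ->
    `|(Wt n)^-1 *: (\sum_(i < n) wt i *: q (kap i)) - q (kap n)| <= e.
  move=> e0; have e2 : 0 < e / 2 by lra.
  have [i0 hi0] := q_slow _ e2.
  exists (maxn i0.+1 (Num.truncn (e / 2)^-1).+1) => -[//|n] _; rewrite geq_max => /andP[k1 k2].
  have [k0 h] := near n; apply: le_trans h _.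
  have := hi0 (kap n.+1).-1; rewrite prednK// => /(_ _)/ltW h1.
  have {}h1 := h1 ltac:(by rewrite -ltnS prednK).
  have h2 : (kap n.+1)%:R^-1 <= e / 2.
    rewrite invf_ple ?posrE ?ltr0n//; apply: ltW; apply: lt_le_trans (truncnS_gt _) _.
    by rewrite ler_nat.
  by lra.
exists (q \o kap); split=> /=; first by move=> i; exact: qC.
- move=> e e0; have [K hK] := err e e0; have [n0 hn0] := grow K.
  exists n0.+1 => n nn; exists (q (kap n)) => //; apply: hK; first exact: leq_trans nn.
  by apply: hn0; exact: ltnW.
- move=> c Cc e e0 n0; have e2 : 0 < e / 2 by lra.
  have [K hK] := err _ e2.
  have [k kk hk] := q_dense c Cc _ e2 (maxn n0 K).+1.
  have [n kn en] := onto k; exists n.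
    by apply: leq_trans kn; apply: leq_trans kk; rewrite leqW// leq_maxl.
  have := hK n (leq_ltn_trans (leq0n _) (leq_trans kk kn)) _; rewrite en => /(_ _) h.
  have {}h := h (leq_trans (leqW (leq_maxr _ _)) kk).
  rewrite -(subrK (q k) (_ *: _)) -addrA.
  by apply: le_trans (ler_normD _ _) _; lra.
Qed.

End Targets.

(** * Statistics of the coded points *)

(** The argument [z] is the symbol following the word; recording it makes the count additive under
    concatenation. *)
Fixpoint switches (w : seq 'I_3) (z : 'I_3) : nat :=
  if w is a :: w' then ((a != head z w') + switches w' z)%N else 0%N.

Lemma switches_cat u v z : switches (u ++ v) z = (switches u (head z v) + switches v z)%N.
Proof.
elim: u => //= a u IH; rewrite IH addnA; congr (_ + _ + _)%N.
by case: (u).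
Qed.

Lemma switches_nseq n j z : (switches (nseq n j) z <= 1)%N.
Proof. by elim: n => //= -[|n] IH /=; [rewrite addn0 leq_b1|rewrite eqxx]. Qed.

Lemma switches_word ds z : (switches (word ds) z <= 2 * size ds)%N.
Proof.
elim: ds z => [|d ds IH] z //; rewrite word_cons switches_cat mulnS leq_add//.
by rewrite /digit_word switches_cat -[2%N]/(1 + 1)%N leq_add ?switches_nseq//= addn0 leq_b1.
Qed.

Lemma changes_mkseq om N : changes om N = switches (mkseq om N) (om N).
Proof.
elim: N => [|N IH]; first by rewrite /changes big_ord0.
by rewrite mkseqS -cats1 switches_cat /= addn0 -IH /changes big_ord_recr.
Qed.

Lemma visits_mkseq om j N : visits om j N = count_mem j (mkseq om N).
Proof.
elim: N => [|N IH]; first by rewrite /visits big_ord0.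
by rewrite mkseqS -cats1 count_cat /= addn0 -IH /visits big_ord_recr.
Qed.

Section StageStatistics.
Variable R : realType.
Local Notation V := (R * R * R)%type.
Variables (p : nat -> V) (L : nat).
Hypothesis p_simplex : forall i, simplex (p i).

Definition vcoord (v : V) (j : 'I_3) : R :=
  if j == s0 then v.1.1 else if j == s1 then v.1.2 else v.2.

Lemma p_ge0 i j : 0 <= vcoord (p i) j.
Proof. by have [h0 h1 h2 _] := p_simplex i; rewrite /vcoord; case: ifP => // _; case: ifP. Qed.

Definition runlen i j : nat := Num.truncn (wt R i * vcoord (p i) j).

(* The initial digit (1,0,0) keeps the coded point away from both ends of the
   cylinder of the preceding free word, which yields the gaps between branches. *)
Definition block i : seq digit :=
  [:: (s1, 0%N, s0); (s0, runlen i s0, s1); (s1, runlen i s1, s2); (s2, runlen i s2, s0)].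

Lemma runlen_itv i j : (runlen i j)%:R <= wt R i * vcoord (p i) j < (runlen i j).+1%:R.
Proof. by apply: truncn_itv; rewrite mulr_ge0 ?p_ge0// ltW ?wt_gt0. Qed.

Lemma size_block i : size (word (block i)) = (runlen i s0 + runlen i s1 + runlen i s2 + 8)%N.
Proof.
by rewrite /block /word /digit_word /=; do 4 rewrite ?(size_cat, size_nseq) /=; lia.
Qed.

Lemma count_block i j : count_mem j (word (block i)) =
  (runlen i j + 3 - (j == s2))%N.
Proof.
rewrite /block /word /digit_word /=; do 4 rewrite ?(count_cat, count_nseq) /=.
by elim/ord3_ind: j => /=; rewrite ?(mul0n, mul1n); lia.
Qed.

Variable om : nat -> seq digit.
Hypothesis om_branch : forall i, om i \in Dpow L (i.+1 ^ 2).

Definition stage i : seq digit := om i ++ block i.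

Lemma om_ok i : all digit_ok (om i). Proof. by have [] := mem_Dpow (om_branch i). Qed.
Lemma size_om i : size (om i) = (i.+1 ^ 2)%N. Proof. by have [] := mem_Dpow (om_branch i). Qed.

Lemma size_word_om i : (size (word (om i)) <= L.+1 * i.+1 ^ 2)%N.
Proof.
have [sz _] := mem_Dpow (om_branch i); rewrite -sz.
elim: (om i) => [|d ds IH]; first by [].
move=> /andP[dL /IH {}IH].
rewrite word_cons size_cat [size (d :: ds)]/= mulnS leq_add// /digit_word size_cat size_nseq /= addn1.
by rewrite ltnS.
Qed.

Lemma stage_ok i : all digit_ok (stage i). Proof. by rewrite all_cat om_ok. Qed.

Lemma stage_mid i : s1 \in word (stage i).
Proof. by rewrite /stage word_cat mem_cat [X in _ || X]inE eqxx orbT. Qed.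

Let x := pt R stage.
Let sy := sym stage.
Let sz n := size (word (stages stage n)).

Lemma sym_stages n : mkseq sy (sz n) = word (stages stage n).
Proof.
apply: (@eq_from_nth _ s0); first by rewrite size_mkseq.
move=> i; rewrite size_mkseq => isz; rewrite nth_mkseq//.
exact: (symE stage_mid).
Qed.

Lemma size_stagesS n : sz n.+1 = (sz n + size (word (stage n)))%N.
Proof. by rewrite /sz stagesS word_cat size_cat. Qed.

Lemma size_stages_digits n : (size (stages stage n) <= 5 * n ^ 3)%N.
Proof.
elim: n => // n IH; rewrite stagesS size_cat /stage size_cat size_om /=.
rewrite (leq_trans (leq_add IH (leqnn _)))//; rewrite !expnS !expn0; nia.
Qed.

(** One constant for all the errors in [partial_stage]: the time and the visits use 2L + 23, the
    changes of symbol 10. *)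
Definition dev_const : R := 2 * L%:R + 32.

Definition wsum n j : R := \sum_(i < n) wt R i * vcoord (p i) j.

Lemma stage_count_dev i j :
  `|(count_mem j (word (stage i)))%:R - wt R i * vcoord (p i) j| <= (L%:R + 11) * i.+1%:R ^+ 2.
Proof.
rewrite /stage word_cat count_cat count_block natrD.
have /andP[h1 h2] := runlen_itv i j.
have hu : (count_mem j (word (om i)))%:R <= (L%:R + 1) * i.+1%:R ^+ 2 :> R.
  rewrite natr1 -natrX -natrM ler_nat; exact: leq_trans (count_size _ _) (size_word_om i).
have u0 : 0 <= (count_mem j (word (om i)))%:R :> R by [].
have i1 : 1 <= i.+1%:R ^+ 2 :> R by rewrite -natrX ler1n expn_gt0.
have hb : (runlen i j)%:R <= (runlen i j + 3 - (j == s2))%N%:R :> R.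
  by rewrite ler_nat; case: eqP => _; lia.
have hb' : (runlen i j + 3 - (j == s2))%N%:R <= (runlen i j)%:R + 3 :> R.
  by rewrite -natrD ler_nat; case: eqP => _; lia.
rewrite -natr1 in h2.
by rewrite ler_norml; apply/andP; split; lra.
Qed.

Lemma wt_sum i : vcoord (p i) s0 + vcoord (p i) s1 + vcoord (p i) s2 = 1.
Proof. by have [_ _ _] := p_simplex i. Qed.

Lemma stage_size_ge i : wt R i <= (size (word (stage i)))%:R.
Proof.
rewrite /stage word_cat size_cat size_block !natrD.
have /andP[_ a] := runlen_itv i s0; have /andP[_ b] := runlen_itv i s1.
have /andP[_ c] := runlen_itv i s2.
rewrite -natr1 in a; rewrite -natr1 in b; rewrite -natr1 in c.
have u0 : 0 <= (size (word (om i)))%:R :> R by [].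
have : wt R i = wt R i * vcoord (p i) s0 + wt R i * vcoord (p i) s1 + wt R i * vcoord (p i) s2.
  by rewrite -!mulrDr wt_sum mulr1.
by lra.
Qed.

Lemma stage_size_le i : (size (word (stage i)))%:R <= wt R i + (L%:R + 11) * i.+1%:R ^+ 2.
Proof.
rewrite /stage word_cat size_cat size_block !natrD.
have /andP[a _] := runlen_itv i s0; have /andP[b _] := runlen_itv i s1.
have /andP[c _] := runlen_itv i s2.
have i1 : 1 <= i.+1%:R ^+ 2 :> R by rewrite -natrX ler1n expn_gt0.
have hu : (size (word (om i)))%:R <= (L%:R + 1) * i.+1%:R ^+ 2 :> R.
  by rewrite natr1 -natrX -natrM ler_nat; exact: size_word_om.
have : wt R i = wt R i * vcoord (p i) s0 + wt R i * vcoord (p i) s1 + wt R i * vcoord (p i) s2.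
  by rewrite -!mulrDr wt_sum mulr1.
by lra.
Qed.

Lemma cube_step (c : R) n : 0 <= c -> c * n%:R ^+ 3 + c * n.+1%:R ^+ 2 <= c * n.+1%:R ^+ 3.
Proof.
move=> c0; rewrite -mulrDr ler_wpM2l// -natr1.
by have := ler0n R n; move: (n%:R : R) => y y0; nra.
Qed.

Lemma dev_coef_ge0 : 0 <= L%:R + 11 :> R. Proof. by rewrite addr_ge0. Qed.

Lemma stages_count_dev n j :
  `|(count_mem j (word (stages stage n)))%:R - wsum n j| <= (L%:R + 11) * n%:R ^+ 3.
Proof.
elim: n => [|n IH]; first by rewrite /wsum big_ord0 subrr normr0 expr0n mulr0.
rewrite stagesS word_cat count_cat natrD /wsum big_ord_recr/= -/(wsum n j) opprD addrACA.
apply: le_trans (ler_normD _ _) _; apply: le_trans (lerD IH (stage_count_dev n j)) _.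
exact: cube_step dev_coef_ge0.
Qed.

Lemma stages_size_dev n : Wt R n <= (sz n)%:R <= Wt R n + (L%:R + 11) * n%:R ^+ 3.
Proof.
elim: n => [|n /andP[IH1 IH2]]; first by rewrite /Wt big_ord0 /= expr0n mulr0 addr0 lexx.
rewrite size_stagesS natrD /Wt big_ord_recr/= -/(Wt R n).
have := stage_size_ge n; have := stage_size_le n; have := cube_step n dev_coef_ge0.
by move=> *; apply/andP; split; lra.
Qed.

(** An unfinished stage has length of order n^3, like the errors accumulated before it, against a
    time of order n^4. The frequencies therefore need no analysis inside a stage. *)
Lemma partial_stage n N : (sz n <= N <= sz n.+1)%N ->
  [/\ Wt R n <= N%:R, N%:R <= Wt R n + dev_const * n.+1%:R ^+ 3,
      forall j, `|(visits sy j N)%:R - wsum n j| <= dev_const * n.+1%:R ^+ 3 &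
      (changes sy N)%:R <= dev_const * n.+1%:R ^+ 3].
Proof.
move=> /andP[h1 h2].
have /andP[d1 d2] := stages_size_dev n.
have n1 : 1 <= n.+1%:R :> R by rewrite ler1n.
have c23 : n.+1%:R ^+ 2 <= n.+1%:R ^+ 3 :> R by rewrite ler_weXn2l.
have cn : n%:R ^+ 3 <= n.+1%:R ^+ 3 :> R by rewrite lerXn2r ?nnegrE ?ler0n// ler_nat.
have c3 : 0 <= n.+1%:R ^+ 3 :> R by rewrite exprn_ge0.
have L0 : 0 <= L%:R :> R by [].
have Ncmp : N%:R <= (sz n)%:R + (L%:R + 12) * n.+1%:R ^+ 3 :> R.
  have : N%:R <= (sz n)%:R + (size (word (stage n)))%:R :> R.
    by rewrite -natrD -size_stagesS ler_nat.
  have := stage_size_le n; rewrite /wt => a b.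
  have := ler_wpM2l dev_coef_ge0 c23; lra.
have Ln := ler_wpM2l dev_coef_ge0 cn.
split.
- by apply: le_trans d1 _; rewrite ler_nat.
- by rewrite /dev_const; lra.
- move=> j.
  have e1 : (visits sy j (sz n))%:R = (count_mem j (word (stages stage n)))%:R :> R.
    by rewrite visits_mkseq sym_stages.
  have := stages_count_dev n j; rewrite -e1.
  have m1 : (visits sy j (sz n) <= visits sy j N)%N.
    rewrite /visits -!(big_mkord xpredT (fun k => (sy k == j) : nat)).
    by rewrite [leqRHS](big_cat_nat (n := sz n))//= leq_addr.
  have m2 : (visits sy j N <= visits sy j (sz n) + (N - sz n))%N.
    rewrite /visits -!(big_mkord xpredT (fun k => (sy k == j) : nat)).
    rewrite [leqLHS](big_cat_nat (n := sz n))//= leq_add2l.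
    rewrite -[leqRHS]muln1 -sum_nat_const_nat.
    by apply: leq_sum => k _; exact: leq_b1.
  move: m1 m2; rewrite -(@ler_nat R) => m1; rewrite -(@ler_nat R) natrD natrB// => m2.
  by rewrite !ler_norml /dev_const => /andP[a b]; apply/andP; split; lra.
- have : (changes sy N <= changes sy (sz n.+1))%N.
    rewrite /changes -!(big_mkord xpredT (fun k => (sy k != sy k.+1) : nat)).
    by rewrite [leqRHS](big_cat_nat (n := N))//= leq_addr.
  rewrite [in leqRHS]changes_mkseq sym_stages => /leq_trans /(_ (switches_word _ _)) h.
  have := leq_trans h (leq_mul (leqnn 2) (size_stages_digits n.+1)).
  rewrite mulnA -(@ler_nat R) natrM natrX /= => {}h.
  rewrite /dev_const; have := ler_wpM2r c3 L0; rewrite mul0r; lra.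
Qed.

Let A n : V := (Wt R n)^-1 *: (\sum_(i < n) wt R i *: p i).

Lemma vcoord_avg n j : vcoord (A n) j = wsum n j / Wt R n.
Proof.
have sumE (k : nat) : vcoord (\sum_(i < k) wt R i *: p i) j = wsum k j.
  elim: k => [|k IH]; first by rewrite /wsum !big_ord0 /vcoord; case: ifP => // _; case: ifP.
  rewrite big_ord_recr /wsum big_ord_recr/= -/(wsum k j) -IH.
  by rewrite /vcoord; case: ifP => // _; case: ifP.
by rewrite mulrC -sumE /A /vcoord; case: ifP => // _; case: ifP.
Qed.

Lemma stage_tail (e : R) : 0 < e -> exists n0, forall n, (n0 <= n)%N ->
  dev_const * n.+1%:R ^+ 3 <= e * Wt R n.
Proof.
move=> e0; have K0 : 0 < dev_const by rewrite /dev_const ltr_wpDl// mulr_ge0.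
(* 32 = 8 * 4: replacing the cube by the preceding one costs 8, and [Wt_ge] loses 4. *)
exists (Num.truncn (32 * dev_const / e)).+1 => -[//|n] hn.
have hn' : 32 * dev_const <= e * n.+1%:R.
  rewrite [leRHS]mulrC -ler_pdivrMr//; apply: ltW; apply: lt_le_trans (truncnS_gt _) _.
  by rewrite ler_nat.
apply: (@le_trans _ _ (e * (n.+1%:R ^+ 4 / 4))); last by rewrite ler_wpM2l ?Wt_ge ?(ltW e0).
have h8 : n.+2%:R ^+ 3 <= 8 * n.+1%:R ^+ 3 :> R.
  have -> : 8 * n.+1%:R ^+ 3 = (2 * n.+1%:R) ^+ 3 :> R by ring.
  by rewrite lerXn2r ?nnegrE// -natrM ler_nat; lia.
apply: (le_trans (ler_wpM2l (ltW K0) h8)).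
have -> : e * (n.+1%:R ^+ 4 / 4) = (e * n.+1%:R) * n.+1%:R ^+ 3 / 4 by ring.
have : 32 * dev_const * n.+1%:R ^+ 3 <= e * n.+1%:R * n.+1%:R ^+ 3 by rewrite ler_wpM2r// exprn_ge0.
by lra.
Qed.

Lemma Wt_gt0 n : 0 < Wt R n.+1.
Proof. by rewrite /Wt big_ord_recr /= ltr_wpDl ?wt_gt0// sumr_ge0// => i _; rewrite ltW ?wt_gt0. Qed.

Lemma freq_close (e : R) : 0 < e -> exists n0, forall n N, (n0 <= n)%N ->
  (sz n <= N <= sz n.+1)%N -> `|freq R sy N - A n| <= e.
Proof.
move=> e0; have e2 : 0 < e / 2 by lra.
have [n0 hn0] := stage_tail e2.
exists n0.+1 => -[//|n] N nn hN.
have [W1 W2 cD _] := partial_stage hN.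
have tail := hn0 n.+1 (ltnW nn).
have W0 := Wt_gt0 n.
have N0 : 0 < N%:R :> R by exact: lt_le_trans W1.
have coord j : `|(visits sy j N)%:R / N%:R - vcoord (A n.+1) j| <= e.
  rewrite vcoord_avg.
  have a0 : 0 <= wsum n.+1 j.
    by apply: sumr_ge0 => i _; rewrite mulr_ge0 ?p_ge0// ltW ?wt_gt0.
  have a1 : wsum n.+1 j <= Wt R n.+1.
    apply: ler_sum => i _; rewrite ler_piMr ?(ltW (wt_gt0 _ _))//.
    have := wt_sum i; have := p_ge0 i s0; have := p_ge0 i s1; have := p_ge0 i s2.
    by move: j {a0} => j; elim/ord3_ind: j => *; lra.
  move: (cD j); set c := (visits _ _ _)%:R; move: (wsum _ _) a0 a1 => a a0 a1 hc.
  move: (Wt R n.+1) (dev_const * _) W1 W2 W0 tail a1 hc => W K W1 W2 W0 tail a1 hc.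
  (* Separates the error in the count from the error in the total time. *)
  have -> : c / N%:R - a / W = (c - a) / N%:R - (a / W) * ((N%:R - W) / N%:R).
    by field; rewrite !gt_eqF.
  have aW : 0 <= a / W <= 1 by rewrite divr_ge0 ?(ltW W0)//= ler_pdivrMr// mul1r.
  have b1 : `|(c - a) / N%:R| <= e / 2.
    rewrite normrM normfV (gtr0_norm N0) ler_pdivrMr//.
    by apply: le_trans hc _; apply: le_trans tail _; rewrite ler_wpM2l// ltW.
  have b2 : 0 <= (N%:R - W) / N%:R <= e / 2.
    rewrite divr_ge0 ?subr_ge0 ?(ltW N0)//= ler_pdivrMr//.
    have : e / 2 * W <= e / 2 * N%:R by rewrite ler_wpM2l// ltW.
    by lra.
  move: b1 b2 aW; move: (_ / N%:R) (_ / N%:R) (a / W) => b1 b2 b3.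
  rewrite ler_norml => /andP[? ?] /andP[? ?] /andP[? ?].
  rewrite ler_norml; apply/andP; split; nra.
by apply: prod3_norm_le; [exact: (coord s0)|exact: (coord s1)|exact: (coord s2)].
Qed.

Lemma stage_of N : exists n, (sz n <= N < sz n.+1)%N.
Proof.
have bnd n : (sz n <= N -> n <= N)%N by apply: leq_trans; exact: (stages_size stage_mid).
have ex : exists n, (sz n <= N)%N by exists 0%N.
case: (ex_maxnP ex bnd) => n hn mx; exists n; rewrite hn /= ltnNge; apply/negP => /mx.
by rewrite ltnn.
Qed.

Lemma sz_homo n m : (n <= m)%N -> (sz n <= sz m)%N.
Proof. by move=> /(stages_prefix stage)[v e]; rewrite /sz e size_cat leq_addr. Qed.

Lemma stage_of_large n0 N : (sz n0 <= N)%N -> exists2 n, (n0 <= n)%N & (sz n <= N <= sz n.+1)%N.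
Proof.
move=> h; have [n /andP[h1 h2]] := stage_of N; exists n; last by rewrite h1 ltnW.
by rewrite leqNgt; apply/negP => /sz_homo; rewrite leqNgt (leq_ltn_trans h).
Qed.

Lemma stage_few_changes (e : R) : 0 < e ->
  exists N0, forall N, (N0 <= N)%N -> (changes sy N)%:R <= e * N%:R.
Proof.
move=> e0; have [n0 hn0] := stage_tail e0; exists (sz n0) => N /stage_of_large[n nn hN].
have [W1 _ _ h] := partial_stage hN; apply: le_trans h _; apply: le_trans (hn0 _ nn) _.
by rewrite ler_wpM2l// ltW.
Qed.

Lemma freq_eventually (e : R) n0 : 0 < e -> exists N0, forall N, (N0 <= N)%N ->
  exists2 n, (n0 <= n)%N & `|freq R sy N - A n| <= e.
Proof.
move=> e0; have [n1 h] := freq_close e0; exists (sz (maxn n0 n1)) => N /stage_of_large[n].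
by rewrite geq_max => /andP[nn0 nn1] hN; exists n => //; exact: h.
Qed.

Lemma freq_at_stages (e : R) : 0 < e -> exists n0, forall n, (n0 <= n)%N ->
  exists2 N, (n <= N)%N & `|freq R sy N - A n| <= e.
Proof.
move=> e0; have [n0 h] := freq_close e0; exists n0 => n nn; exists (sz n).
  exact: (stages_size stage_mid).
by apply: h => //; rewrite leqnn sz_homo.
Qed.

End StageStatistics.

(** * Masses and gaps *)

Section Gap.
Variable R : realType.
Local Notation V := (R * R * R)%type.
Local Notation inv_word := (@inv_word R).
Local Notation cyl := (@cyl R).
Local Notation rho := (rho R).
Local Notation dist_const := (dist_const R).

(** 217 = 1 + 72 * 3; one symbol shrinks a cylinder by at most this factor. *)
Lemma qf_le s x y : 0 <= x <= 1 -> 0 <= y <= 1 -> qf s x y <= 217 :> R.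
Proof.
move=> /andP[x0 x1] /andP[y0 y1]; have /andP[a0 a1] := xi_01 R s.
have c0 := cubic_coef_gt0 R s.
have c72 : cubic_coef R s <= 72 by rewrite /cubic_coef; case: ifP; lra.
rewrite /qf; set T := (X in cubic_coef R s * X).
have T3 : T <= 3.
  rewrite /T.
  have t : -1 <= x - xi R s <= 1 by apply/andP; split; lra.
  have u : -1 <= y - xi R s <= 1 by apply/andP; split; lra.
  by move: (x - _) (y - _) t u => t u /andP[? ?] /andP[? ?]; nra.
by nra.
Qed.

Lemma cyl_ge w : 217^-1 ^+ size w <= cyl w.
Proof.
elim: w => [|s w IH]; first by rewrite expr0 cyl0.
rewrite exprS; have := qf_le s (inv_word0_01 R (s :: w)) (inv_word1_01 R (s :: w)).
have := cyl_cons R s w; have := cyl_gt0 R (s :: w); move: (qf _ _ _) => q X0 e q1.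
rewrite mulrC ler_pdivrMr//; apply: le_trans IH _.
by rewrite -e ler_wpM2l// ltW.
Qed.

(** The polynomial loss of [cyl_run_ge] is weakened to an exponential in m, through m + 1 <=
    2^(m+1), because exponentials combine over the stages. The power 21 is 3 * 7. *)
Lemma cyl_digit_word_ge d m : (d.1.2.+2 <= 3 * m.+1 ^ 3)%N ->
  ((3 * 3 ^+ 7 * 2 ^+ 21)^-1 : R) ^+ m.+1 <= cyl (digit_word d).
Proof.
case: d => [[j l] e] /= hl; have := @cyl_run_ge R l.+1 j e.
rewrite -/(digit_word (j, l, e)).
have hl2 : (l.+2 <= 3 * (2 ^ m.+1) ^ 3)%N.
  by apply: leq_trans hl _; rewrite leq_mul2l /= leq_exp2r//; exact: ltnW (ltn_expl _ _).
have : l.+2%:R ^+ 7 <= (3 * (2 ^+ m.+1) ^+ 3) ^+ 7 :> R.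
  apply: lerXn2r; rewrite ?nnegrE ?mulr_ge0 ?exprn_ge0//.
  by rewrite -!natrX -natrM ler_nat.
have -> : (3 * (2 ^+ m.+1) ^+ 3) ^+ 7 = 3 ^+ 7 * (2 ^+ 21) ^+ m.+1 :> R.
  by rewrite exprMn -!exprM; congr (_ * 2 ^+ _); lia.
have X0 := cyl_gt0 R (digit_word (j, l, e)); move: (cyl _) X0 => X X0.
have b1 : 1 <= 3 * 3 ^+ 7 :> R by lra.
have b2 : 3 * 3 ^+ 7 <= (3 * 3 ^+ 7) ^+ m.+1 :> R by rewrite -[leLHS]expr1 ler_weXn2l.
move=> h1 h2; rewrite exprVn -[leLHS]mul1r ler_pdivrMr; last by rewrite exprn_gt0// !mulr_gt0// exprn_gt0.
rewrite [leRHS](_ : _ = X * ((3 * 3 ^+ 7) ^+ m.+1 * (2 ^+ 21) ^+ m.+1)); last by rewrite -exprMn.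
apply: le_trans h2 _; apply: (le_trans (ler_wpM2l _ h1)); first by rewrite mulr_ge0// ltW.
set B := _ ^+ m.+1 in h1 *.
rewrite (_ : 3 * X * _ = X * (3 * 3 ^+ 7 * B)); last by ring.
by rewrite ler_wpM2l ?(ltW X0)// ler_wpM2r// !exprn_ge0.
Qed.

Variables (p : nat -> V) (L : nat).
Hypothesis p_simplex : forall i, simplex (p i).
Local Notation block := (block p).

Lemma runlen_le i j : (runlen p i j <= i.+1 ^ 3)%N.
Proof.
rewrite -(@ler_nat R) natrX; have /andP[h _] := runlen_itv p_simplex i j.
apply: le_trans h _; rewrite -/(wt R i) ler_piMr ?(ltW (wt_gt0 _ _))//.
have := wt_sum p_simplex i; have := p_ge0 p_simplex i s0.
have := p_ge0 p_simplex i s1; have := p_ge0 p_simplex i s2.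
by elim/ord3_ind: j => *; lra.
Qed.

Definition digit_ratio : R := dist_const^-1 * (3 * 3 ^+ 7 * 2 ^+ 21)^-1.

Lemma digit_ratio_gt0 : 0 < digit_ratio.
Proof. by rewrite mulr_gt0 ?invr_gt0 ?dist_const_gt0// !mulr_gt0// exprn_gt0. Qed.

Lemma cyl_digit_cat_ge d m v : digit_ok d -> (d.1.2.+2 <= 3 * m.+1 ^ 3)%N ->
  digit_ratio ^+ m.+1 * cyl v <= cyl (digit_word d ++ v).
Proof.
move=> dok hd; have dsok : all digit_ok [:: d] by rewrite /= dok.
have := cyl_word_cat_ge R v dsok; rewrite /word /= cats0 => h.
have h2 := cyl_digit_word_ge hd.
rewrite /digit_ratio exprMn; apply: (@le_trans _ _ (dist_const^-1 * (cyl (digit_word d) * cyl v))).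
  rewrite -[leLHS]mulrA; apply: ler_pM.
  - by rewrite exprn_ge0// invr_ge0 ltW ?dist_const_gt0.
  - by rewrite mulr_ge0 ?(ltW (cyl_gt0 _ _))// exprn_ge0// invr_ge0 !mulr_ge0// exprn_ge0.
  - rewrite -[leRHS]expr1; apply: ler_wiXn2l => //.
      by rewrite invr_ge0 ltW ?dist_const_gt0.
    by rewrite invf_le1 ?dist_const_gt0 ?dist_const_ge1.
  - by rewrite ler_wpM2r ?(ltW (cyl_gt0 _ _)).
by rewrite mulrC ler_pdivrMr ?dist_const_gt0// [leRHS]mulrC.
Qed.

Lemma word_cons_cat d ds v : word (d :: ds) ++ v = digit_word d ++ (word ds ++ v).
Proof. by rewrite word_cons -(catA (digit_word d)). Qed.

Lemma cyl_block_cat_ge i v : (digit_ratio ^+ 4) ^+ i.+1 * cyl v <= cyl (word (block i) ++ v).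
Proof.
have i3 : (1 <= i.+1 ^ 3)%N by rewrite expn_gt0.
have hl j : ((runlen p i j).+2 <= 3 * i.+1 ^ 3)%N by have := runlen_le i j; lia.
have t0 : 0 <= digit_ratio ^+ i.+1 by rewrite exprn_ge0// ltW ?digit_ratio_gt0.
rewrite /block !word_cons_cat.
rewrite exprAC (_ : (digit_ratio ^+ i.+1) ^+ 4 * cyl v =
  digit_ratio ^+ i.+1 * (digit_ratio ^+ i.+1 * (digit_ratio ^+ i.+1 * (digit_ratio ^+ i.+1 * cyl v)))); last by ring.
have step d v' X : digit_ok d -> (d.1.2.+2 <= 3 * i.+1 ^ 3)%N -> X <= cyl v' ->
    digit_ratio ^+ i.+1 * X <= cyl (digit_word d ++ v').
  move=> dok hd Xv; apply: (le_trans _ (cyl_digit_cat_ge v' dok hd)).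
  by rewrite ler_wpM2l.
by do 4 (apply: (step) => //; first by [exact: hl|rewrite /=; lia]).
Qed.

Section Branch.
Variable om : nat -> seq digit.
Hypothesis om_branch : forall i, om i \in Dpow L (i.+1 ^ 2).
Local Notation stage := (stage p om).
Local Notation W n := (word (stages stage n)).

(** Only the free words enter, since they alone carry the mass; the fixed blocks are accounted for
    by the loss factor [stage_ratio]. *)
Definition cylprod n : R := \prod_(i < n) cyl (word (om i)).
Definition stage_ratio : R := dist_const^-1 * digit_ratio ^+ 4.

Lemma stage_ratio_gt0 : 0 < stage_ratio.
Proof. by rewrite mulr_gt0 ?invr_gt0 ?dist_const_gt0// exprn_gt0// digit_ratio_gt0. Qed.

Lemma stage_ratio_le1 : stage_ratio <= 1.
Proof.
have K1 : dist_const^-1 <= 1 by rewrite invf_le1 ?dist_const_gt0 ?dist_const_ge1.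
have K0 : 0 <= dist_const^-1 by rewrite invr_ge0 ltW ?dist_const_gt0.
rewrite /stage_ratio mulr_ile1 ?exprn_ge0 ?(ltW digit_ratio_gt0)// exprn_ile1 ?(ltW digit_ratio_gt0)//.
rewrite /digit_ratio mulr_ile1// ?invr_ge0 ?mulr_ge0 ?exprn_ge0// invf_le1 ?mulr_gt0 ?exprn_gt0//.
by lra.
Qed.

Lemma cylprod_gt0 n : 0 < cylprod n.
Proof. by apply: prodr_gt0 => i _; exact: cyl_gt0. Qed.

(** Stage i loses [stage_ratio ^+ i.+1] to its block and to distortion, and 1 + ... + n <= n^2. *)
Lemma cyl_stages_ge n v :
  cylprod n * stage_ratio ^+ (n ^ 2) * cyl v <= cyl (W n ++ v).
Proof.
elim: n v => [|n IH] v; first by rewrite /cylprod big_ord0 expr0 !mul1r.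
rewrite stagesS word_cat -catA; apply: le_trans (IH _).
rewrite /cylprod big_ord_recr/= -/(cylprod n) /stage word_cat -catA.
have h1 := cyl_word_cat_ge R (word (block n) ++ v) (om_ok om_branch n).
have h2 := cyl_block_cat_ge n v.
have t0 := stage_ratio_gt0.
have K0 := dist_const_gt0 R.
have t4 : stage_ratio ^+ (n.+1 ^ 2) <= stage_ratio ^+ (n ^ 2) * stage_ratio ^+ n.+1.
  rewrite -exprD ler_wiXn2l ?(ltW t0) ?stage_ratio_le1//; nia.
have t5 : stage_ratio ^+ n.+1 <= dist_const^-1 * (digit_ratio ^+ 4) ^+ n.+1.
  rewrite exprMn ler_wpM2r ?exprn_ge0 ?(ltW digit_ratio_gt0)//.
  rewrite -[leRHS]expr1; apply: ler_wiXn2l => //.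
    by rewrite invr_ge0 ltW.
  by rewrite invf_le1 ?dist_const_ge1.
have h3 : dist_const^-1 * (digit_ratio ^+ 4) ^+ n.+1 * (cyl (word (om n)) * cyl v) <=
    cyl (word (om n) ++ word (block n) ++ v).
  rewrite -mulrA mulrC ler_pdivrMr// [leRHS]mulrC; apply: le_trans h1.
  by rewrite mulrCA ler_wpM2l ?(ltW (cyl_gt0 _ _)).
have a0 := cylprod_gt0 n; have b0 := cyl_gt0 R (word (om n)); have c0 := cyl_gt0 R v.
rewrite [leLHS](_ : _ = cylprod n * (stage_ratio ^+ (n.+1 ^ 2) * (cyl (word (om n)) * cyl v))); last by ring.
rewrite -[leRHS]mulrA ler_wpM2l ?(ltW a0)//.
apply: (@le_trans _ _ (stage_ratio ^+ (n ^ 2) * stage_ratio ^+ n.+1 * (cyl (word (om n)) * cyl v))).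
  by rewrite ler_wpM2r// mulr_ge0 ?ltW.
rewrite -mulrA ler_wpM2l ?exprn_ge0 ?(ltW t0)//.
by apply: le_trans h3; rewrite ler_wpM2r// mulr_ge0 ?ltW.
Qed.

(** The free word of stage [n] is absent from [cylprod om n]. It has at most (L+1)(n+1)^2 symbols,
    each paid for at the crude rate 1/217. *)
Definition prefix_ratio : R := stage_ratio * (217^-1) ^+ L.+1.

Lemma prefix_ratio_gt0 : 0 < prefix_ratio.
Proof. by rewrite mulr_gt0 ?stage_ratio_gt0// exprn_gt0. Qed.

Lemma prefix_ratio_le1 : prefix_ratio <= 1.
Proof.
rewrite /prefix_ratio mulr_ile1 ?(ltW stage_ratio_gt0) ?stage_ratio_le1// exprn_ile1//; lra.
Qed.

Lemma cyl_prefix_ge n : cylprod n * prefix_ratio ^+ (n.+1 ^ 2) <= cyl (W n ++ word (om n)).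
Proof.
apply: le_trans (cyl_stages_ge _ _); rewrite -mulrA ler_wpM2l ?(ltW (cylprod_gt0 n))//.
rewrite /prefix_ratio exprMn; apply: ler_pM; rewrite ?exprn_ge0 ?(ltW stage_ratio_gt0)//.
  rewrite ler_wiXn2l ?(ltW stage_ratio_gt0) ?stage_ratio_le1//; nia.
apply: le_trans (cyl_ge _); rewrite -exprM; apply: ler_wiXn2l; [lra|lra|].
exact: size_word_om.
Qed.

Lemma pt_position n : inv_word (W n ++ word (om n) ++ [:: s1]) 0 <= pt R stage <=
  inv_word (W n ++ word (om n) ++ [:: s1]) 1.
Proof.
have := @pt_in R stage n.+1.
rewrite stagesS word_cat /stage word_cat.
have [v ->] : exists v, word (block n) = [:: s1] ++ v by exists (behead (word (block n))).
rewrite !catA; move: (_ ++ [:: s1]) => u; rewrite !inv_word_cat => /andP[h0 h1].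
have /andP[v0 _] := inv_word0_01 R v; have /andP[_ v1] := inv_word1_01 R v.
by apply/andP; split; [apply: le_trans h0|apply: (le_trans h1)]; rewrite inv_word_mono.
Qed.

(** The free word is followed by [s1], so the subcylinders of [s0] and [s2] lie between the point
    and the two ends; each has length at least 1/(3 [dist_const]) of the whole. *)
Lemma pt_inside n :
  [/\ 0 <= pt R stage <= 1,
      cyl (W n ++ word (om n)) <= 3 * dist_const * (pt R stage - inv_word (W n ++ word (om n)) 0) &
      cyl (W n ++ word (om n)) <= 3 * dist_const * (inv_word (W n ++ word (om n)) 1 - pt R stage)].
Proof.
have /andP[h0 h1] := pt_position n.
have ok : all digit_ok (stages stage n ++ om n).
  rewrite all_cat (om_ok om_branch) andbT.
  elim: n {h0 h1} => // n IH; rewrite stagesS all_cat IH; exact: (stage_ok _ om_branch).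
move: h0 h1; rewrite catA -word_cat; set u := word _ in ok *.
have hs s : cyl u <= 3 * (dist_const * cyl (u ++ [:: s])).
  by have := cyl_word_cat_ge R [:: s] ok; rewrite cyl1 -/u; lra.
rewrite !inv_word_cat => h0 h1; have := hs s0; have := hs s2; rewrite !cyl_cat_sub => a2 a0.
have K0 := dist_const_gt0 R.
have e01 : inv_word [:: s0] 1 = inv_word [:: s1] 0 by rewrite /= inv0 inv1.
have e12 : inv_word [:: s2] 0 = inv_word [:: s1] 1 by rewrite /= inv0 inv1.
rewrite e01 in a0; rewrite e12 in a2.
have z0 : inv_word u (inv_word [:: s0] 0) = inv_word u 0 by rewrite /= inv0 mul0r.
have z1 : inv_word u (inv_word [:: s2] 1) = inv_word u 1 by rewrite /= inv1 divff.
rewrite z0 in a0; rewrite z1 in a2; split.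
- have /andP[? _] := inv_word_01 u (inv_word0_01 R [:: s1]); have /andP[_ ?] := inv_word_01 u (inv_word1_01 R [:: s1]).
  by apply/andP; split; lra.
- apply: le_trans a0 _; rewrite -mulrA ler_wpM2l// ler_wpM2l ?(ltW K0)// lerD2r//.
- by apply: le_trans a2 _; rewrite -mulrA ler_wpM2l// ler_wpM2l ?(ltW K0)// lerD2l lerN2.
Qed.

End Branch.

(** The points lie in non-overlapping cylinders, so their distance is at least that from the first
    point to the end of its own cylinder facing the other; [pt_inside] bounds it below. *)
Lemma branch_gap om om' n : (forall i, om i \in Dpow L (i.+1 ^ 2)) ->
  (forall i, om' i \in Dpow L (i.+1 ^ 2)) -> mkseq om n = mkseq om' n -> om n <> om' n ->
  cyl (word (stages (stage p om) n) ++ word (om n)) <=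
  3 * dist_const * `|pt R (stage p om) - pt R (stage p om')|.
Proof.
move=> b b' e ne.
have es : stages (stage p om') n = stages (stage p om) n.
  rewrite /stages /mkseq; congr flatten; apply/eq_in_map => i; rewrite mem_iota add0n => /andP[_ ilt].
  rewrite /stage; congr (_ ++ _).
  by have := congr1 (fun s => nth [::] s i) e; rewrite /= !nth_mkseq.
have [_ h1 h2] := pt_inside b n; have [_ h1' h2'] := pt_inside b' n.
rewrite es in h1' h2'.
have sp : sep R (word (stages (stage p om) n) ++ word (om n))
    (word (stages (stage p om) n) ++ word (om' n)).
  apply: sep_cat; rewrite -(cats0 (word (om n))) -(cats0 (word (om' n))).
  apply: sep_word; rewrite ?(om_ok b) ?(om_ok b')//; last exact/eqP.
  by rewrite (size_om b) (size_om b').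
have K0 : 0 < 3 * dist_const by rewrite mulr_gt0 ?dist_const_gt0.
have c0 := cyl_gt0 R (word (stages (stage p om) n) ++ word (om n)).
have c0' := cyl_gt0 R (word (stages (stage p om) n) ++ word (om' n)).
have i1' : 0 <= pt R (stage p om') - inv_word (word (stages (stage p om) n) ++ word (om' n)) 0.
  by rewrite -(pmulr_rge0 _ K0); apply: le_trans h1'; exact: ltW.
have i2' : 0 <= inv_word (word (stages (stage p om) n) ++ word (om' n)) 1 - pt R (stage p om').
  by rewrite -(pmulr_rge0 _ K0); apply: le_trans h2'; exact: ltW.
case: sp => sp.
- apply: le_trans h2 _; rewrite ler_wpM2l ?(ltW K0)// distrC.
  by apply: le_trans (ler_norm _); lra.
- apply: le_trans h1 _; rewrite ler_wpM2l ?(ltW K0)//.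
  by apply: le_trans (ler_norm _); lra.
Qed.

Definition Zsum i : R := \sum_(u <- Dpow L (i.+1 ^ 2)) cyl (word u).
Definition prob i (u : seq digit) : R := cyl (word u) / Zsum i.
Definition Rsum n : nat := (\sum_(i < n) i.+1 ^ 2)%N.

Variables (s theta : R).
Hypothesis s01 : 0 < s < 1.
Hypothesis theta01 : 0 < theta < 1.
Hypothesis rho_theta : rho `^ (1 - s) <= theta ^+ 2.
Hypothesis Z_ge : forall i, theta ^+ (i.+1 ^ 2) <= Zsum i.

Lemma Z_gt0 i : 0 < Zsum i.
Proof. by apply: lt_le_trans (Z_ge i); rewrite exprn_gt0//; have /andP[] := theta01. Qed.

Lemma prob_ge0 i u : 0 <= prob i u.
Proof. by rewrite divr_ge0 ?(ltW (cyl_gt0 _ _)) ?(ltW (Z_gt0 i)). Qed.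

Lemma prob_sum i : \sum_(u <- Dpow L (i.+1 ^ 2)) prob i u = 1.
Proof. by rewrite /prob -big_distrl/= divff// gt_eqF// Z_gt0. Qed.

Lemma rho01 : 0 < rho < 1. Proof. by rewrite /rho; apply/andP; split; lra. Qed.

(** Write c = c^s c^(1-s) for the cylinder length c of a word of r digits. The surplus c^(1-s) is at
    most theta^(2r): one theta^r absorbs the normalisation, the other is saved to pay for the blocks
    and the last free word. *)
Lemma prob_le i u : u \in Dpow L (i.+1 ^ 2) ->
  prob i u <= cyl (word u) `^ s * theta ^+ (i.+1 ^ 2).
Proof.
move=> /mem_Dpow[sz ok _]; have /andP[t0 t1] := theta01; have /andP[r0 r1] := rho01.
have /andP[? ?] := s01.
have c0 := cyl_gt0 R (word u).
rewrite /prob ler_pdivrMr ?Z_gt0//.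
have h : cyl (word u) <= cyl (word u) `^ s * (theta ^+ (i.+1 ^ 2) * theta ^+ (i.+1 ^ 2)).
  have hc : cyl (word u) `^ s * cyl (word u) `^ (1 - s) = cyl (word u).
    rewrite -powRD; last by rewrite (gt_eqF c0) implybT.
    by rewrite (_ : s + (1 - s) = 1) ?powRr1 ?(ltW c0)//; lra.
  rewrite -[leLHS]hc ler_wpM2l ?powR_ge0// -expr2 -exprM mulnC exprM.
  apply: (@le_trans _ _ ((rho `^ (1 - s)) ^+ (i.+1 ^ 2))).
    rewrite -powR_mulrn ?powR_ge0// -powRrM mulrC powRrM powR_mulrn ?(ltW r0)// -sz.
    apply: ge0_ler_powR; rewrite ?nnegrE ?exprn_ge0 ?(ltW r0) ?(ltW c0)//; first by lra.
    exact: cyl_word_le.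
  by apply: lerXn2r; rewrite ?nnegrE ?powR_ge0 ?exprn_ge0 ?(ltW t0).
apply: le_trans h _; by rewrite mulrA ler_wpM2l ?Z_ge// mulr_ge0 ?powR_ge0// exprn_ge0// ltW.
Qed.

Lemma mass_le om n : (forall i, om i \in Dpow L (i.+1 ^ 2)) ->
  mass [::] prob (mkseq om n) <= cylprod om n `^ s * theta ^+ Rsum n.
Proof.
move=> b; elim: n => [|n IH].
  by rewrite /mass /cylprod /Rsum /= !big_ord0 powR1 expr0 mulr1.
rewrite mkseqS mass_rcons size_mkseq /cylprod /Rsum !big_ord_recr/= -/(cylprod om n) -/(Rsum n).
rewrite powRM ?(ltW (cylprod_gt0 _ _)) ?(ltW (cyl_gt0 _ _))// exprD mulrACA.
apply: ler_pM => //; first exact: mass_ge0 prob_ge0 _.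
- exact: prob_ge0.
- exact: prob_le.
Qed.

Lemma Rsum_ge q : exists Q, forall n, (q * n.+1 ^ 2 <= Rsum n + Q)%N.
Proof.
(* Once n > 2q, the increment q(2n + 3) of the left side is at most the new term (n+1)^2; smaller n
   are covered by this constant. *)
exists (q * (2 * q + 2) ^ 2)%N.
elim=> [|n IH]; first by rewrite /Rsum big_ord0; nia.
rewrite /Rsum big_ord_recr/= -/(Rsum n).
have [le|lt] := leqP n (2 * q); last by nia.
apply: (@leq_trans (q * (2 * q + 2) ^ 2)); last exact: leq_addl.
by rewrite leq_mul2l leq_exp2r// orbC; lia.
Qed.

Lemma theta_Rsum : exists2 C1 : R, 0 < C1 & forall n, theta ^+ Rsum n <= C1 * prefix_ratio ^+ (n.+1 ^ 2).
Proof.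
have /andP[t0 t1] := theta01.
have [q hq] : exists q, theta ^+ q <= prefix_ratio.
  have /cvgrPdist_le/(_ _ prefix_ratio_gt0)[N _ /(_ N (leqnn N))] : (fun k => theta ^+ k) @ \oo --> (0 : R).
    by apply: cvg_expr; rewrite gtr0_norm.
  by rewrite /= sub0r normrN ger0_norm ?exprn_ge0 ?(ltW t0)// => h; exists N.
have [Q hQ] := Rsum_ge q.
exists (theta ^- Q); first by rewrite invr_gt0 exprn_gt0.
move=> n; rewrite ler_pdivlMl ?exprn_gt0// -exprD addnC.
apply: (@le_trans _ _ (theta ^+ (q * n.+1 ^ 2))).
  by apply: ler_wiXn2l => //; exact: ltW.
by rewrite exprM; apply: lerXn2r; rewrite ?nnegrE ?exprn_ge0 ?(ltW t0) ?(ltW prefix_ratio_gt0).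
Qed.

Lemma mass_gap_bound : exists2 C0 : R, 0 < C0 & forall om om' n,
  (forall i, om i \in Dpow L (i.+1 ^ 2)) -> (forall i, om' i \in Dpow L (i.+1 ^ 2)) ->
  mkseq om n = mkseq om' n -> om n <> om' n ->
  mass [::] prob (mkseq om n) <= C0 * `|pt R (stage p om) - pt R (stage p om')| `^ s.
Proof.
have [C1 C10 hC] := theta_Rsum; have /andP[s0 s1] := s01.
have K3 : 0 < 3 * dist_const by rewrite mulr_gt0 ?dist_const_gt0.
exists (C1 * (3 * dist_const) `^ s); first by rewrite mulr_gt0// powR_gt0.
move=> om om' n b b' e ne; apply: le_trans (mass_le n b) _.
have gap := branch_gap b b' e ne; have pre := cyl_prefix_ge b n.
have M0 := cylprod_gt0 om n.
apply: (@le_trans _ _ (cylprod om n `^ s * (C1 * prefix_ratio ^+ (n.+1 ^ 2)))).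
  by rewrite ler_wpM2l ?powR_ge0.
rewrite mulrCA -[leRHS]mulrA ler_wpM2l ?(ltW C10)// -powRM ?(ltW K3)//.
set T := prefix_ratio ^+ _; have T0 : 0 < T by rewrite exprn_gt0// prefix_ratio_gt0.
have T1 : T <= 1 by rewrite exprn_ile1 ?(ltW prefix_ratio_gt0) ?prefix_ratio_le1.
(* As T and s are at most 1, T <= T^s, so the loss factor can enter the s-th power together with
   [cylprod]. *)
apply: (@le_trans _ _ (cylprod om n `^ s * T `^ s)).
  by rewrite ler_wpM2l ?powR_ge0// ger1_powR ?T0 ?T1// ltW.
rewrite -powRM ?(ltW M0) ?(ltW T0)//.
apply: ge0_ler_powR; rewrite ?nnegrE ?mulr_ge0 ?(ltW M0) ?(ltW T0) ?(ltW K3) ?(ltW (dist_const_gt0 R))//; first exact: ltW.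
exact: le_trans pre gap.
Qed.

Lemma mass_vanishes (om : nat -> seq digit) (e : R) : (forall i, om i \in Dpow L (i.+1 ^ 2)) -> 0 < e ->
  exists n, mass [::] prob (mkseq om n) <= e.
Proof.
move=> b e0; have /andP[t0 t1] := theta01; have /andP[s0 s1] := s01.
have /cvgrPdist_le/(_ _ e0)[n _ /(_ n (leqnn n))] : (fun k => theta ^+ k) @ \oo --> (0 : R).
  by apply: cvg_expr; rewrite gtr0_norm.
rewrite /= sub0r normrN ger0_norm ?exprn_ge0 ?(ltW t0)// => h; exists n.
apply: le_trans (mass_le n b) _; apply: le_trans h.
rewrite -[leRHS]mul1r; apply: ler_pM; rewrite ?powR_ge0 ?exprn_ge0 ?(ltW t0)//.
  have M0 := cylprod_gt0 om n.
  have M1 : cylprod om n <= 1 by apply: prodr_ile1 => i _; rewrite (ltW (cyl_gt0 _ _)) cyl_le1.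
  apply: (@le_trans _ _ (1 `^ s)); last by rewrite powR1.
  apply: ge0_ler_powR; rewrite ?nnegrE ?(ltW M0)//; exact: ltW.
apply: ler_wiXn2l; rewrite ?(ltW t0) ?(ltW t1)//.
rewrite -[X in (X <= _)%N]card_ord -[X in (X <= _)%N]muln1 -sum_nat_const /Rsum.
by apply: leq_sum => i _; rewrite expn_gt0.
Qed.

End Gap.

(** * Choice of the parameters for a given s < 1 *)

Section Largeness.
Variable R : realType.
Local Notation V := (R * R * R)%type.

Lemma runs_shrink (e : R) : 0 < e -> exists L, forall j, cyl R (nseq L.+1 j) <= e.
Proof.
move=> e0; exists (Num.truncn (e ^- 2)) => j.
set L := Num.truncn _; have hL : e ^- 2 < L.+1%:R by exact: truncnS_gt.
have := cyl_nseq_sq R L.+1 j; have c0 := cyl_gt0 R (nseq L.+1 j).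
have e2 : 0 < e ^+ 2 by rewrite exprn_gt0.
have : 1 < L.+1%:R * e ^+ 2 by rewrite -ltr_pdivrMr// mul1r.
move: (L.+1%:R : R) (ler0n R L.+1) (cyl _ _) c0 => M M0 c c0 h1 h2.
rewrite leNgt; apply/negP => ec.
have h3 : e ^+ 2 <= c ^+ 2 by apply: lerXn2r; rewrite ?nnegrE ?ltW.
by have := ler_wpM2l M0 h3; lra.
Qed.

Lemma measure_neq0_of_branches (p : nat -> V) (E : set R) s :
  (forall i, simplex (p i)) ->
  (forall L (om : nat -> seq digit), (forall i, om i \in Dpow L (i.+1 ^ 2)) -> E (pt R (stage p om))) ->
  0 < s -> s < 1 -> hausdorff_measure s E <> 0%E.
Proof.
move=> ps hE s0 s1; have s01 : 0 < s < 1 by rewrite s0.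
have /andP[r0 r1] := rho01 R.
pose theta := rho R `^ ((1 - s) / 2).
have t0 : 0 < theta by rewrite powR_gt0.
have t1 : theta < 1.
  rewrite -[ltRHS](_ : 1 `^ ((1 - s) / 2) = 1); last by rewrite powR1.
  by apply: gt0_ltr_powR; rewrite ?nnegrE ?(ltW r0)//; lra.
have theta01 : 0 < theta < 1 by rewrite t0.
have rt : rho R `^ (1 - s) <= theta ^+ 2.
  by rewrite -powR_mulrn ?(ltW t0)// -powRrM (_ : (1 - s) / 2 * 2%:R = 1 - s)//; field.
have K0 := dist_const_gt0 R.
(* With this bound on the overlong runs, the factor kept per digit in [Dpow_sum_ge] is exactly
   theta. *)
have e0 : 0 < (1 - theta) / (3 * dist_const R) by rewrite divr_gt0 ?subr_gt0// mulr_gt0.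
have [L hL] := runs_shrink e0.
have te : 1 - 3 * dist_const R * ((1 - theta) / (3 * dist_const R)) = theta by field; rewrite gt_eqF.
have Zge i : theta ^+ (i.+1 ^ 2) <= Zsum R L i.
  by rewrite -{1}te; apply: Dpow_sum_ge => //; lra.
have [C0 C00 gap] := mass_gap_bound ps s01 theta01 rt Zge.
apply: (@tree_measure_neq0 R _ [::] (fun i => Dpow L (i.+1 ^ 2)) (prob R L)
  _ _ _ (fun om => pt R (stage p om)) E s C0) => //.
- by move=> n; exact: Dpow_uniq.
- by move=> i u; exact: (prob_ge0 theta01 Zge).
- by move=> i; exact: (prob_sum theta01 Zge).
- by move=> om b; exact: (hE L).
- by move=> om e b e0'; exact: (mass_vanishes s01 theta01 rt Zge).
Qed.

Lemma in_I01_sub (P : R -> Prop) : [set x : R | x \in `[0, 1] /\ P x] `<=` `[0, 1].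
Proof. by move=> x []. Qed.

Lemma dim_target (P : R -> Prop) (p : nat -> V) : (forall i, simplex (p i)) ->
  (forall L (om : nat -> seq digit), (forall i, om i \in Dpow L (i.+1 ^ 2)) -> P (pt R (stage p om))) ->
  hausdorff_dim [set x : R | x \in `[0, 1] /\ P x] = 1%:E.
Proof.
move=> ps hP; apply: dim_eq1; first exact: in_I01_sub.
move=> s s0 s1; apply: (measure_neq0_of_branches ps) => // L om b; split; last exact: (hP L).
by have [h _ _] := pt_inside p b 0; rewrite in_itv.
Qed.

End Largeness.

Theorem theorem2 (R : realType) :
  (forall C : set (R * R * R),
      C `<=` @simplex R -> C !=set0 -> closed C -> connected C ->
      hausdorff_dim [set x : R | x \in `[0, 1] /\ V_eq_piC x C] = 1%:E)
  /\
  (forall p : R * R * R, @simplex R p ->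
      hausdorff_dim [set x : R | x \in `[0, 1] /\ emp_cvg_to x p] = 1%:E).
Proof.
have near_target (C : set (R * R * R)) (p : nat -> R * R * R) L om :
    (forall i, simplex (p i)) -> (forall i, om i \in Dpow L (i.+1 ^ 2)) ->
    (forall e : R, 0 < e -> exists n0, forall n, (n0 <= n)%N -> exists2 c, C c &
      `|(Wt R n)^-1 *: (\sum_(i < n) wt R i *: p i) - c| <= e) ->
    forall e : R, 0 < e -> exists N0, forall N, (N0 <= N)%N ->
      exists2 c, C c & `|freq R (sym (stage p om)) N - c| <= e.
  move=> ps b h e e0; have e2 : 0 < e / 2 by lra.
  have [n0 hn0] := h _ e2; have [N0 hN0] := freq_eventually ps b n0 e2.
  exists N0 => N /hN0[n /hn0[c Cc hc] hN]; exists c => //.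
  set A := (Wt R n)^-1 *: _ in hc hN; rewrite -(subrK A (freq _ _ _)) -addrA.
  by apply: le_trans (ler_normD _ _) _; lra.
split=> [C Csub Cne Ccl Cconn|q qS].
- have [p [pC near visits]] := averages_target Csub Cne Cconn.
  have ps i := Csub _ (pC i).
  apply: (dim_target ps) => L om b.
  have cd := @coded_pt R _ (stage_mid p om); have fc := stage_few_changes ps b.
  apply: (V_of_freq cd fc Ccl Csub).
    exact: (near_target _ _ _ _ ps b near).
  move=> c Cc e e0 N0; have e2 : 0 < e / 2 by lra.
  have [n0 hn0] := freq_at_stages ps b e2.
  have [n] := visits c Cc _ e2 (maxn n0 N0); rewrite geq_max => /andP[nn0 nN0] hc.
  have [N nN hN] := hn0 n nn0; exists N; first exact: leq_trans nN.
  set A := (Wt R n)^-1 *: _ in hc hN; rewrite -(subrK A (freq _ _ _)) -addrA.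
  by apply: le_trans (ler_normD _ _) _; lra.
(* Convergence is the case of the connected set {q}: all targets equal [q], and the frequencies stay
   near it from some time on. *)
- have sub1 : [set q] `<=` @simplex R by move=> _ ->.
  have [p [pq near _]] := averages_target sub1 (ex_intro _ q erefl) (@connected1 _ q).
  have ps i := sub1 _ (pq i).
  apply: (dim_target ps) => L om b.
  have cd := @coded_pt R _ (stage_mid p om); have fc := stage_few_changes ps b.
  apply: (emp_cvg_to_freq cd fc) => e e0.
  have [N0 hN0] := near_target _ _ _ _ ps b near e e0.
  by exists N0 => N /hN0[_ ->].
Qed.
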